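(* Let $(M,\mathsf{M})$ be a $C^r$-manifold, $U,V\subset M$ open subsets with $M=U\cup V$, and $W=U\cap V$. Suppose that the set $\mathcal{D}((U,W),(V,W))$ of $C^r$-diffeomorphisms $\eta:(U,\mathsf{U})\to(V,\mathsf{V})$ with $\eta(W)=W$ is non-empty. 1) For every $\eta\in\mathcal{D}((U,W),(V,W))$ there is an action of the wreath product $\mathcal{E}_U(W)\wr\mathbb{Z}_2$ on $\mathcal{D}(W)$ given by the following rule: for $(a,b,\delta)\in\mathcal{E}_U(W)\wr\mathbb{Z}_2$ and $g\in\mathcal{D}(W)$, $$(a,b,\delta)\cdot g=\begin{cases}\eta\,(b\,\eta^{-1}g\,a^{-1})=(\eta b\eta^{-1})\,g\,a^{-1}, & \delta=+1,\\ \eta\,(b\,\eta^{-1}g\,a^{-1})^{-1}=(\eta a)\,g^{-1}(\eta b^{-1}), & \delta=-1,\end{cases}$$ where $\eta$ stands for its restriction $W\to W$ and products denote compositions. 2) The partition of $\mathcal{D}(W)$ into the orbits of this action does not depend on the particular choice of $\eta\in\mathcal{D}((U,W),(V,W))$. The set of orbits is denoted by $\mathcal{E}_U(W)\setminus\mathcal{D}(W)^{\pm1}/\mathcal{E}_U(W)$, and its elements are called $(\mathcal{E}_U(W),\pm)$-double cosets. 3) The correspondence $\mathsf{A}=\{(U,\phi),(V,\psi)\}\mapsto g_{\mathsf{A}}=\psi\circ\phi^{-1}|_W$, associating to each $(U,V)$-atlas $\mathsf{A}$ on $M$ its transition map $g_{\mathsf{A}}\in\mathcal{D}(W)$, yields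 an injection $\mu$ - of the set $\mathfrak{C}^r(M,\mathsf{U},\mathsf{V})/\mathcal{H}(M,\{U,V\})$ of all $C^r$-structures on $M$ induced by some $(U,V)$-atlas, up to a $C^r$-diffeomorphism leaving $U$ and $V$ invariant or exchanging them, - into the set $\mathcal{E}_U(W)\setminus\mathcal{D}(W)^{\pm1}/\mathcal{E}_U(W)$ of $(\mathcal{E}_U(W),\pm)$-double cosets. Moreover, $\mu$ is a bijection if and only if every $g\in\mathcal{D}(W)$ is the transition map of some $(U,V)$-atlas on $M$.
   Context: Fix $r\in\{1,2,\ldots,\infty\}$. Manifolds are topological spaces locally homeomorphic to open subsets of cones $K=\{x\in P: f_1(x)\ge0,\ldots,f_k(x)\ge0\}$ with non-empty interior, where $P$ is a finite-dimensional real vector space and the $f_i$ are linear; they are not assumed Hausdorff or second countable. A map between open subsets of cones is $C^r$ if it extends to a $C^r$-map between open subsets of the ambient Euclidean spaces. A $C^r$-atlas is a family of charts (open embeddings of open subsets into cones) with domains covering the space and $C^r$-diffeomorphic transition maps; a $C^r$-structure is a maximal $C^r$-atlas; a $C^r$-manifold is a manifold with a fixed $C^r$-atlas. Let $\mathsf{U},\mathsf{V},\mathsf{W}$ be the restrictions of the atlas $\mathsf{M}$ to $U,V,W$ (each chart is restricted to the intersection of its domain with the given open set). A $(U,V)$-atlas on $M$ is a pair $\mathsf{A}=\{\phi:U\to U,\ \psi:V\to V\}$ of homeomorphisms with $\phi(W)=W=\psi(W)$ such that the transition map $g_{\mathsf{A}}=\psi\circ\phi^{-1}|_W:(W,\mathsf{W})\to(W,\mathsf{W})$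 is a $C^r$-diffeomorphism. It induces a $C^r$-atlas $\mathsf{Q}_{\mathsf{A}}$ on $M$ consisting of all charts $(\phi^{-1}(O),\kappa\circ\phi)$, $(O,\kappa)\in\mathsf{U}$, and $(\psi^{-1}(O),\kappa\circ\psi)$, $(O,\kappa)\in\mathsf{V}$. Let $\mathfrak{C}^r(M,\mathsf{U},\mathsf{V})$ be the set of all $C^r$-structures on $M$ containing $\mathsf{Q}_{\mathsf{A}}$ for some $(U,V)$-atlas $\mathsf{A}$. $\mathcal{H}(M,\{U,V\})$ is the group of homeomorphisms $h:M\to M$ such that either $h(U)=U$, $h(V)=V$ or $h(U)=V$, $h(V)=U$. Two structures define the same element of $\mathfrak{C}^r(M,\mathsf{U},\mathsf{V})/\mathcal{H}(M,\{U,V\})$ iff some $h\in\mathcal{H}(M,\{U,V\})$ is a $C^r$-diffeomorphism from $M$ with the first structure to $M$ with the second. $\mathcal{D}(W)$ is the group of $C^r$-diffeomorphisms of $(W,\mathsf{W})$, and $\mathcal{E}_U(W)\subset\mathcal{D}(W)$ is the subgroup of all restrictions to $W$ of $C^r$-diffeomorphisms of $(U,\mathsf{U})$ that map $W$ onto $W$. For a group $E$, the wreath product $E\wr\mathbb{Z}_2$ ($\mathbb{Z}_2=\{\pm1\}$) is the set $E\times E\times\mathbb{Z}_2$ with the operation $(c,d,\delta)(a,b,+1)=(ca,db,\delta)$ and $(c,d,\delta)(a,b,-1)=(da,cb,-\delta)$. *)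

(* Defs.v *)
From HB Require Import structures.
From mathcomp Require Import all_boot all_order all_algebra.
From mathcomp Require Import all_classical all_reals all_analysis.

Set Implicit Arguments.
Unset Strict Implicit.
Unset Printing Implicit Defensive.

Import Order.TTheory GRing.Theory Num.Theory.
Import numFieldNormedType.Exports.

Local Open Scope classical_set_scope.
Local Open Scope ring_scope.

(** [None] stands for r = oo and [Some m] for r = m. *)
Definition smoothness := option nat.

Definition le_smoothness (k : nat) (r : smoothness) : bool :=
  if r is Some m then (k <= m)%N else true.

Section Cr.
Context {R : realType}.

(** On [O]: class C^0 means continuous, and class C^(k+1) means differentiable
    with a derivative of class C^k. As the space of linear maps is finite
    dimensional, the latter is expressed by the evaluations [x |-> 'd f x v]. *)
Fixpoint Ck {n m : nat} (k : nat) (O : set 'rV[R]_n) (f : 'rV[R]_n -> 'rV[R]_m)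
    : Prop :=
  if k is k'.+1 then
    (forall x, O x -> differentiable f x) /\
    (forall v, Ck k' O (fun x => 'd f x v))
  else forall x, O x -> {for x, continuous f}.

Definition Cr_open (r : smoothness) {n m : nat} (O : set 'rV[R]_n)
    (f : 'rV[R]_n -> 'rV[R]_m) : Prop :=
  forall k, le_smoothness k r -> Ck k O f.

(** For [p] injective on [S]: the map [q \o p^-1] from [p @` S] to [q @` S]
    is of class C^r, that is, it extends to a map of class C^r defined on an
    open subset of the ambient space of [p @` S]. *)
Definition Cr_rep (r : smoothness) {T : Type} {n m : nat} (S : set T)
    (p : T -> 'rV[R]_n) (q : T -> 'rV[R]_m) : Prop :=
  exists (O : set 'rV[R]_n) (F : 'rV[R]_n -> 'rV[R]_m),
    [/\ open O, p @` S `<=` O, Cr_open r O F & forall x, S x -> F (p x) = q x].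

End Cr.

Section Charts.
Context {R : realType}.

(** The finite dimensional vector spaces containing the cones are taken in
    coordinates, as spaces of row vectors; the dimension and the cone may vary
    from chart to chart. *)
Definition cone {n k : nat} (f : 'I_k -> {linear 'rV[R]_n -> R^o})
    : set 'rV[R]_n :=
  [set x | forall i, 0 <= f i x].

(** Only the values of [chart_map] on [chart_dom] are meaningful. None of the
    notions below depends on the others; in particular a maximal atlas contains,
    along with a chart, all the charts that agree with it on its domain. *)
Record chart (M : topologicalType) := Chart {
  chart_dim : nat;
  chart_dom : set M;
  chart_map : M -> 'rV[R]_chart_dim }.

Definition is_chart (M : topologicalType) (c : chart M) : Prop :=
  open (chart_dom c) /\
  exists (k : nat) (f : 'I_k -> {linear 'rV[R]_(chart_dim c) -> R^o}),
    [/\ (cone f)° !=set0,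
        forall x, chart_dom c x -> cone f (chart_map c x),
        {in chart_dom c &, injective (chart_map c)},
        forall x, chart_dom c x -> {for x, continuous (chart_map c)}
      & forall A, open A -> A `<=` chart_dom c ->
          exists2 B, open B & chart_map c @` A = cone f `&` B].

Definition Cr_compatible (r : smoothness) (M : topologicalType)
    (c d : chart M) : Prop :=
  Cr_rep r (chart_dom c `&` chart_dom d) (chart_map c) (chart_map d) /\
  Cr_rep r (chart_dom c `&` chart_dom d) (chart_map d) (chart_map c).

Definition Cr_atlas (r : smoothness) (M : topologicalType)
    (A : set (chart M)) : Prop :=
  [/\ forall c, A c -> is_chart c,
      \bigcup_(c in A) chart_dom c = setT
    & forall c d, A c -> A d -> Cr_compatible r c d].

Definition Cr_structure (r : smoothness) (M : topologicalType)
    (S : set (chart M)) : Prop :=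
  Cr_atlas r S /\
  forall A, Cr_atlas r A -> S `<=` A -> A = S.

Definition Cr_map (r : smoothness) (M N : topologicalType)
    (A : set (chart M)) (B : set (chart N)) (f : M -> N) : Prop :=
  continuous f /\
  forall c d, A c -> B d ->
    Cr_rep r (chart_dom c `&` f @^-1` chart_dom d)
      (chart_map c) (chart_map d \o f).

Definition chart_restr (M : topologicalType) (U : set M) (c : chart M)
    : chart (U : topologicalType) :=
  Chart (set_val @^-1` chart_dom c) (chart_map c \o (set_val : U -> M)).

Definition atlas_restr (M : topologicalType) (U : set M) (A : set (chart M))
    : set (chart (U : topologicalType)) :=
  [set chart_restr U c | c in A].

(** The chart [(f^-1(O), k \o f)] on [M], for a chart [(O, k)] on [U] and
    [f : U -> U]; the value outside [U] is arbitrary. *)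
Definition chart_pull (M : topologicalType) (U : set M) (f : U -> U)
    (c : chart (U : topologicalType)) : chart M :=
  Chart (set_val @` (f @^-1` chart_dom c))
    (fun x => oapp (chart_map c \o f) 0 (insub x : option U)).

End Charts.
Arguments chart R M : clear implicits.
Arguments atlas_restr {R M} U A.

Record homeo (X Y : topologicalType) := Homeo {
  hfun :> X -> Y;
  hinv : Y -> X;
  hfunK : cancel hfun hinv;
  hinvK : cancel hinv hfun;
  hfun_cont : continuous hfun;
  hinv_cont : continuous hinv }.

Lemma homeo_eq (X Y : topologicalType) (f g : homeo X Y) :
  (forall x, f x = g x) -> f = g.
Proof.
move: f g => [f f' fK f'K cf cf'] [g g' gK g'K cg cg'] /= fg.
have {}fg : f = g by apply/funext.
subst g; have fg' : f' = g' by apply/funext => y; rewrite -[y in LHS]g'K fK.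
subst g'; congr Homeo; exact: Prop_irrelevance.
Qed.

Definition homeo_id (X : topologicalType) : homeo X X :=
  @Homeo X X id id (fun=> erefl) (fun=> erefl)
    (fun x => @cvg_id _ _) (fun x => @cvg_id _ _).

Definition homeo_inv (X Y : topologicalType) (f : homeo X Y) : homeo Y X :=
  Homeo (@hinvK _ _ f) (@hfunK _ _ f) (@hinv_cont _ _ f) (@hfun_cont _ _ f).

Definition homeo_comp (X Y Z : topologicalType) (g : homeo Y Z) (f : homeo X Y)
    : homeo X Z :=
  @Homeo X Z (g \o f) (hinv f \o hinv g)
    (can_comp (@hfunK _ _ g) (@hfunK _ _ f))
    (can_comp (@hinvK _ _ f) (@hinvK _ _ g))
    (fun x => continuous_comp (@hfun_cont _ _ f x) (@hfun_cont _ _ g (f x)))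
    (fun z => continuous_comp (@hinv_cont _ _ g z)
                (@hinv_cont _ _ f (hinv g z))).

HB.instance Definition _ (X Y : topologicalType) := gen_eqMixin (homeo X Y).
HB.instance Definition _ (X Y : topologicalType) := gen_choiceMixin (homeo X Y).

Section HomeoGroup.
Context {X : topologicalType}.
Implicit Types f g h : homeo X X.

Lemma homeo_compA : associative (@homeo_comp X X X).
Proof. by move=> f g h; apply: homeo_eq. Qed.
Lemma homeo_comp1 : left_id (homeo_id X) (@homeo_comp X X X).
Proof. by move=> f; apply: homeo_eq. Qed.
Lemma homeo_1comp : right_id (homeo_id X) (@homeo_comp X X X).
Proof. by move=> f; apply: homeo_eq. Qed.
Lemma homeo_compV :
  left_inverse (homeo_id X) (@homeo_inv X X) (@homeo_comp X X X).
Proof. by move=> f; apply: homeo_eq => x /=; rewrite hfunK. Qed.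
Lemma homeo_Vcomp :
  right_inverse (homeo_id X) (@homeo_inv X X) (@homeo_comp X X X).
Proof. by move=> f; apply: homeo_eq => x /=; rewrite hinvK. Qed.

End HomeoGroup.

(** The product [f * g] of two self-homeomorphisms is [f \o g]. *)
HB.instance Definition _ (X : topologicalType) :=
  isGroup.Build (homeo X X) (@homeo_compA X) (@homeo_comp1 X)
    (@homeo_1comp X) (@homeo_compV X) (@homeo_Vcomp X).

Definition Cr_diffeo {R : realType} (r : smoothness) (X Y : topologicalType)
    (A : set (chart R X)) (B : set (chart R Y)) : set (homeo X Y) :=
  [set f : homeo X Y | Cr_map r A B f /\ Cr_map r B A (hinv f)].

Section Restriction.
Context {M : topologicalType}.

Definition sub_in {A : set M} (W : set M) : set A := set_val @^-1` W.

Definition maps_onto (A B W : set M) (f : A -> B) : Prop :=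
  f @` sub_in W = sub_in W.

Definition set_incl (W A : set M) (WA : W `<=` A) (w : W) : A :=
  exist _ (set_val w) (mem_set (WA _ (set_valP w))).

Definition corestr (A W : set M) (a : A) (Wa : W (set_val a)) : W :=
  exist _ (set_val a) (mem_set Wa).

Lemma maps_onto_in (A B W : set M) (f : A -> B) (a : A) :
  maps_onto W f -> W (set_val a) -> W (set_val (f a)).
Proof. by move=> fW Wa; have : sub_in W (f a) by rewrite -fW; exists a. Qed.

Lemma maps_onto_inv (A B W : set M) (f : homeo A B) :
  maps_onto W f -> maps_onto W (hinv f).
Proof.
rewrite /maps_onto => <-; apply/seteqP; split=> [a [_ [a' Wa' <-] <-]|a Wa].
  by rewrite hfunK.
by exists (f a); [exists a | rewrite hfunK].
Qed.

Definition restr_fun (A B W : set M) (WA : W `<=` A) (f : A -> B)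
    (fW : maps_onto W f) (w : W) : W :=
  corestr (maps_onto_in (a := set_incl WA w) fW (set_valP w)).

Lemma restr_fun_cont (A B W : set M) (WA : W `<=` A) (f : A -> B)
    (fW : maps_onto W f) :
  continuous f -> continuous (restr_fun WA fW).
Proof.
move=> cf.
have cval (C : set M) : continuous (set_val : C -> M).
  exact: initial_continuous.
have cincl : continuous (set_incl WA).
  apply/continuousP => _ [S oS <-].
  have /continuousP/(_ _ oS) := cval W.
  by congr open; apply/seteqP; split.
apply/continuousP => _ [S oS <-].
have cg : continuous (set_val \o (f \o set_incl WA)).
  move=> w; apply: continuous_comp; last exact: cval.
  by apply: continuous_comp; [exact: cincl | exact: cf].
have /continuousP/(_ _ oS) := cg.
by congr open; apply/seteqP; split.
Qed.

Lemma restr_funK (A B W : set M) (WA : W `<=` A) (WB : W `<=` B)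
    (f : homeo A B) (fW : maps_onto W f) (f'W : maps_onto W (hinv f)) :
  cancel (restr_fun WA fW) (restr_fun WB f'W).
Proof.
move=> w; apply: val_inj => /=.
rewrite -[RHS]/(set_val (set_incl WA w)) -[in RHS](hfunK f (set_incl WA w)).
by congr (set_val (hinv f _)); apply: val_inj.
Qed.

Lemma restr_invK (A B W : set M) (WA : W `<=` A) (WB : W `<=` B)
    (f : homeo A B) (fW : maps_onto W f) (f'W : maps_onto W (hinv f)) :
  cancel (restr_fun WB f'W) (restr_fun WA fW).
Proof. exact: (@restr_funK B A W WB WA (homeo_inv f)). Qed.

Definition restr (A B W : set M) (WA : W `<=` A) (WB : W `<=` B)
    (f : homeo A B) (fW : maps_onto W f) : homeo W W :=
  Homeo (restr_funK WA WB fW (maps_onto_inv fW))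
        (restr_invK WA WB fW (maps_onto_inv fW))
        (restr_fun_cont (WA := WA) (fW := fW) (@hfun_cont _ _ f))
        (restr_fun_cont (WA := WB) (fW := maps_onto_inv fW)
          (@hinv_cont _ _ f)).

End Restriction.

(** [wsign] is the Z_2 component: [true] stands for -1 and [false] for +1. *)
Record wreath (G : Type) := Wreath { wleft : G; wright : G; wsign : bool }.

Section Wreath.
Context {G : groupType}.
Local Open Scope group_scope.

Definition wreath_mul (x y : wreath G) : wreath G :=
  let: Wreath c d s := x in
  let: Wreath a b t := y in
  if t then Wreath (d * a) (c * b) (~~ s) else Wreath (c * a) (d * b) s.

Definition wreath_one : wreath G := Wreath 1 1 false.

Definition wreath_inv (x : wreath G) : wreath G :=
  let: Wreath a b s := x in
  if s then Wreath b^-1 a^-1 true else Wreath a^-1 b^-1 false.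

Lemma wreath_mulA : associative wreath_mul.
Proof. by move=> [a b []] [c d []] [e f []] /=; rewrite !mulgA ?negbK. Qed.
Lemma wreath_mul1 : left_id wreath_one wreath_mul.
Proof. by move=> [a b []] /=; rewrite !mul1g. Qed.
Lemma wreath_1mul : right_id wreath_one wreath_mul.
Proof. by move=> [a b []] /=; rewrite !mulg1. Qed.
Lemma wreath_mulV : left_inverse wreath_one wreath_inv wreath_mul.
Proof. by move=> [a b []] /=; rewrite !mulVg. Qed.
Lemma wreath_Vmul : right_inverse wreath_one wreath_inv wreath_mul.
Proof. by move=> [a b []] /=; rewrite !mulgV. Qed.

End Wreath.

HB.instance Definition _ (G : Type) := gen_eqMixin (wreath G).
HB.instance Definition _ (G : Type) := gen_choiceMixin (wreath G).
HB.instance Definition _ (G : groupType) :=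
  isGroup.Build (wreath G) (@wreath_mulA G) (@wreath_mul1 G)
    (@wreath_1mul G) (@wreath_mulV G) (@wreath_Vmul G).

Definition wreath_set (G : groupType) (E : set G) : set (wreath G) :=
  [set x | E (wleft x) /\ E (wright x)].

Definition is_subgroup (G : groupType) (H : set G) : Prop :=
  [/\ H 1%g, forall x y, H x -> H y -> H (x * y)%g
    & forall x, H x -> H x^-1%g].

Definition is_action (G : groupType) (T : Type) (H : set G) (X : set T)
    (act : G -> T -> T) : Prop :=
  [/\ is_subgroup H,
      forall x t, H x -> X t -> X (act x t),
      forall t, X t -> act 1%g t = t
    & forall x y t, H x -> H y -> X t -> act (x * y)%g t = act x (act y t)].

Definition orbits (G : groupType) (T : Type) (H : set G) (X : set T)
    (act : G -> T -> T) : set (set T) :=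
  [set [set act x t | x in H] | t in X].

Section UV.
Context {R : realType} (r : smoothness) {M : topologicalType}.
Variables (A : set (chart R M)) (U V : set M).

Definition Win : set M := U `&` V.

Lemma Win_l : Win `<=` U. Proof. exact: subIsetl. Qed.
Lemma Win_r : Win `<=` V. Proof. exact: subIsetr. Qed.

Definition restrUU (f : homeo U U) (fW : maps_onto Win f) : homeo Win Win :=
  restr Win_l Win_l fW.
Definition restrVV (f : homeo V V) (fW : maps_onto Win f) : homeo Win Win :=
  restr Win_r Win_r fW.
Definition restrUV (f : homeo U V) (fW : maps_onto Win f) : homeo Win Win :=
  restr Win_l Win_r fW.

Definition diffeoW : set (homeo Win Win) :=
  Cr_diffeo r (atlas_restr Win A) (atlas_restr Win A).

Definition extU : set (homeo Win Win) :=
  [set e | exists (f : homeo U U) (fW : maps_onto Win f),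
     Cr_diffeo r (atlas_restr U A) (atlas_restr U A) f /\ e = restrUU fW].

Definition diffeoUV : set (homeo U V) :=
  [set f | Cr_diffeo r (atlas_restr U A) (atlas_restr V A) f /\
           maps_onto Win f].

Definition wreath_act (eta : homeo Win Win) (x : wreath (homeo Win Win))
    (g : homeo Win Win) : homeo Win Win :=
  let: Wreath a b s := x in
  (if s then eta * (b * eta^-1 * g * a^-1)^-1
   else eta * (b * eta^-1 * g * a^-1))%g.

(** The orbits of the action on [diffeoW] defined by [eta], that is, the
    (E_U(W), +-)-double cosets. *)
Definition double_cosets (eta : homeo Win Win) : set (set (homeo Win Win)) :=
  orbits (wreath_set extU) diffeoW (wreath_act eta).

Definition double_coset (eta g : homeo Win Win) : set (homeo Win Win) :=
  [set wreath_act eta x g | x in wreath_set extU].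

Record uv_atlas := UVAtlas {
  uv_phi : homeo U U;
  uv_psi : homeo V V;
  uv_phiW : maps_onto Win uv_phi;
  uv_psiW : maps_onto Win uv_psi;
  uv_diffeo : diffeoW (restrVV uv_psiW * (restrUU uv_phiW)^-1)%g }.

Definition transition (a : uv_atlas) : homeo Win Win :=
  (restrVV (uv_psiW a) * (restrUU (uv_phiW a))^-1)%g.

Definition induced_atlas (a : uv_atlas) : set (chart R M) :=
  [set chart_pull (uv_phi a) c | c in atlas_restr U A] `|`
  [set chart_pull (uv_psi a) c | c in atlas_restr V A].

Definition uv_structures : set (set (chart R M)) :=
  [set S | Cr_structure r S /\ exists a, induced_atlas a `<=` S].

Definition homeoUV : set (homeo M M) :=
  [set h | (h @` U = U /\ h @` V = V) \/ (h @` U = V /\ h @` V = U)].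

Definition uv_equiv (S T : set (chart R M)) : Prop :=
  exists2 h, homeoUV h & Cr_diffeo r S T h.

Definition uv_class (S : set (chart R M)) : set (set (chart R M)) :=
  [set T | uv_structures T /\ uv_equiv S T].

Definition uv_quotient : set (set (set (chart R M))) :=
  [set uv_class S | S in uv_structures].

End UV.
Arguments diffeoW {R} r {M} A U V.
Arguments extU {R} r {M} A U V.
Arguments diffeoUV {R} r {M} A U V.
Arguments double_cosets {R} r {M} A U V eta.
Arguments double_coset {R} r {M} A U V eta g.

(* Main.v *)
(** The wreath action is an action by group computations. A structure induced
    by a [(U, V)]-atlas [(phi, psi)] makes [phi] and [psi] diffeomorphisms onto
    [U] and [V], so a diffeomorphism [h] between two such structures that
    preserves [U] and [V] is the same as a pair of diffeomorphisms of [U] and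
    [V] intertwining the transition maps; if [h] exchanges [U] and [V] the
    transition map is inverted. As the diffeomorphisms [V -> V] and [U -> V] are
    obtained from those of [U] by composing with [eta], this is exactly the
    relation of being in the same [(E_U(W), +-)]-double coset, whatever [eta].

    Being C^r is a local property, although [Cr_rep] asks for a single
    extension: extensions are glued with a C^oo partition of unity on an open
    subset of R^n. This is what makes C^r maps stable under composition, and
    provides the maximal atlas containing a given atlas. *)

From HB Require Import structures.
Require Import Defs.
From mathcomp Require Import all_boot all_order all_algebra.
From mathcomp Require Import all_classical all_reals all_analysis.
From mathcomp Require Import ring lra.

Set Implicit Arguments.
Unset Strict Implicit.
Unset Printing Implicit Defensive.

Import Order.TTheory GRing.Theory Num.Theory.
Import numFieldNormedType.Exports.

Local Open Scope classical_set_scope.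
Local Open Scope ring_scope.

(** * Calculus of C^k maps *)

(** A homeomorphism of W that extends to a homeomorphism or diffeomorphism X -> Y is treated as an
    arrow from X to Y, where X and Y are among U, V, W. In these terms the coset relation never
    mentions eta, and an exchange of U and V is a pair of arrows crossing between them. The delicate
    point is the last equivalence: surjectivity of mu puts some transition map in every coset, while
    the criterion asks every element of D(W) to be one. Transition maps are the products q p^-1 in
    D(W) with p and q extending topologically to U and V. This form survives the moves of sign +1,
    but inversion leaves factors that cross between U and V. The coset of eta repairs this, because
    it too must contain a transition map. On the analytic side, M may be neither Hausdorff nor
    second countable, so extensions are glued in coordinate space, where rational balls supply
    countability. *)

Section CkGen.
Context {R : realType}.
Implicit Types U V W : normedModType R.

(* [Ck] for maps between arbitrary normed modules: the proof of the chain rule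
   involves scalar factors, and the bump functions a real variable. *)
Fixpoint CkG {U V : normedModType R} (k : nat) (O : set U) (f : U -> V)
    : Prop :=
  if k is k'.+1 then
    (forall x, O x -> differentiable f x) /\
    (forall v, CkG k' O (fun x => 'd f x v))
  else forall x, O x -> {for x, continuous f}.

Lemma CkGE n m k (O : set 'rV[R]_n) (f : 'rV[R]_n -> 'rV[R]_m) :
  Ck k O f <-> CkG k O f.
Proof.
elim: k f => //= k IH f.
by split=> -[df kf]; split=> // v; apply/IH.
Qed.

Lemma is_diff_eps U V (f : U -> V) (df : {linear U -> V}) x :
  continuous df ->
  (forall e, 0 < e -> \forall h \near (0 : U),
     `|f (h + x) - (f x + df h)| <= e * `|h|) ->
  is_diff x f df.
Proof.
move=> cdf fe.
have fE : f \o shift x = cst (f x) + df +o_ 0 id by apply/eqaddoP.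
have dE := diff_unique cdf fE.
by apply: DiffDef => //; apply/diff_locallyP; rewrite dE.
Qed.

Lemma diff_eps U V (f : U -> V) x : differentiable f x ->
  forall e, 0 < e -> \forall h \near (0 : U),
     `|f (h + x) - (f x + 'd f x h)| <= e * `|h|.
Proof. by move=> /diff_locallyP[_ /eqaddoP]. Qed.

Lemma is_diff_val U V (f g : U -> V) x v : is_diff x f g -> 'd f x v = g v.
Proof. by move=> [_ ->]. Qed.

Lemma eq_near_is_diff U V (f g : U -> V) x :
  {near x, f =1 g} -> differentiable f x -> is_diff x g ('d f x).
Proof.
move=> fg df; have fgx := nbhs_singleton fg.
apply: is_diff_eps => [y|e e0]; first exact: diff_continuous.
have fg0 : \forall h \near (0 : U), f (h + x) = g (h + x).
  by move: fg; rewrite (near_shift 0) subr0.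
by have := diff_eps df e0; rewrite -fgx; apply: filterS2 fg0 => h ->.
Qed.

Lemma eq_open_is_diff U V (O : set U) (f g : U -> V) x : open O -> O x ->
  {in O, f =1 g} -> differentiable f x -> is_diff x g ('d f x).
Proof.
move=> oO Ox fg; apply: eq_near_is_diff.
by have := open_nbhs_nbhs (conj oO Ox); apply: filterS => y /mem_set/fg.
Qed.

Lemma eq_CkG U V k (O : set U) (f g : U -> V) : open O -> {in O, f =1 g} ->
  CkG k O f -> CkG k O g.
Proof.
move=> oO; elim: k f g => [|k IH] f g fg /=.
  move=> cf x Ox; move: (cf x Ox); rewrite /prop_for /continuous_at.
  rewrite (fg x (mem_set Ox)); apply: cvg_trans; apply: near_eq_cvg.
  by have := open_nbhs_nbhs (conj oO Ox); apply: filterS => y /mem_set/fg.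
move=> [df kf]; have dg x : O x -> is_diff x g ('d f x).
  by move=> Ox; apply: (eq_open_is_diff oO Ox fg); exact: df.
split=> [x /dg //|v]; apply: IH (kf v) => x /set_mem /dg dgx.
by rewrite (is_diff_val v dgx).
Qed.

Lemma sub_CkG U V k (O O' : set U) (f : U -> V) : O' `<=` O ->
  CkG k O f -> CkG k O' f.
Proof.
move=> sO; elim: k f => [|k IH] f /=; first by move=> cf x /sO; exact: cf.
by move=> [df kf]; split=> [x /sO|v]; [exact: df | exact: IH].
Qed.

(** [CkG] imposes its conditions point by point, on germs in the ambient space, so any sets that
    cover the points of [O] will do. *)
Lemma CkG_local U V k (O : set U) (f : U -> V) :
  (forall x, O x -> exists2 O', O' x & CkG k O' f) -> CkG k O f.
Proof.
elim: k f => [|k IH] f /= fO; first by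
  move=> x Ox; have [N Nx] := fO x Ox; apply.
split=> [x /fO[N Nx [df _]]|v]; first exact: df.
by apply: IH => x /fO[N Nx [_ kf]]; exists N.
Qed.

Lemma CkGS U V k (O : set U) (f : U -> V) : CkG k.+1 O f -> CkG k O f.
Proof.
elim: k f => [|k IH] f [df kf].
  by move=> x /df /differentiable_continuous.
by split=> // v; exact/IH/kf.
Qed.

Lemma CkG_cst U V k (O : set U) (c : V) : CkG k O (fun=> c).
Proof.
elim: k c => [|k IH] c /=; first by move=> x _; exact: cst_continuous.
split=> [x _|v]; first exact: differentiable_cst.
by under eq_fun do rewrite diff_cst.
Qed.

Lemma CkG_linear U V k (O : set U) (f : {linear U -> V}) : continuous f ->
  CkG k O f.
Proof.
case: k => [|k] cf /=; first by move=> x _; exact: cf.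
split=> [x _|v]; first exact: linear_differentiable.
by under eq_fun do rewrite diff_lin//; exact: CkG_cst.
Qed.

Lemma CkGD U V k (O : set U) (f g : U -> V) : open O ->
  CkG k O f -> CkG k O g -> CkG k O (fun x => f x + g x).
Proof.
move=> oO; elim: k f g => [|k IH] f g /=.
  by move=> cf cg x Ox; apply: cvgD; [exact: cf | exact: cg].
move=> [df kf] [dg kg]; split=> [x Ox|v].
  by apply: differentiableD; [exact: df | exact: dg].
apply: eq_CkG (IH _ _ (kf v) (kg v)) => // x /set_mem Ox.
have dfx := differentiableP (df _ Ox); have dgx := differentiableP (dg _ Ox).
by rewrite (is_diff_val v (is_diffD dfx dgx)).
Qed.

Lemma CkG_sum U V k (O : set U) (I : Type) (s : seq I) (f : I -> U -> V) :
  open O -> (forall i, CkG k O (f i)) -> CkG k O (fun x => \sum_(i <- s) f i x).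
Proof.
move=> oO kf; elim: s => [|i s IH].
  by under eq_fun do rewrite big_nil; exact: CkG_cst.
by under eq_fun do rewrite big_cons; exact: CkGD.
Qed.

Lemma CkG_lcomp U V W k (O : set U) (f : U -> V) (l : {linear V -> W}) :
  open O -> continuous l -> CkG k O f -> CkG k O (fun x => l (f x)).
Proof.
move=> oO cl; elim: k f => [|k IH] f /=.
  by move=> cf x Ox; apply: continuous_comp; [exact: cf | exact: cl].
move=> [df kf]; split=> [x Ox|v].
  by apply: differentiable_comp; [exact: df | exact: linear_differentiable].
apply: eq_CkG (IH _ (kf v)) => // x /set_mem Ox.
have dl : is_diff (f x) l l.
  by apply: DiffDef; [exact: linear_differentiable | exact: diff_lin].
by rewrite (is_diff_val v (is_diff_comp (differentiableP (df _ Ox)) dl)).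
Qed.

Lemma scale_is_bilinear V :
  bilinear_for (GRing.Scale.Law.clone _ _ *:%R _)
    (GRing.Scale.Law.clone _ _ *:%R _) ( *:%R : R -> V -> V).
Proof.
split=> [u' a x y|u a x y] /=.
- by rewrite scalerDl scalerA.
- by rewrite scalerDr !scalerA mulrC.
Qed.

(** Product rule, read off from the differential of a continuous bilinear map composed with the pair
    [(a, f)]. *)
Lemma is_diff_scale U V (a : U -> R) (f : U -> V) x :
  differentiable a x -> differentiable f x ->
  is_diff x (fun y => a y *: f y) (fun v => a x *: 'd f x v + 'd a x v *: f x).
Proof.
move=> da df.
pose sm := bilinear_isBilinear.Build R R V V _ _ ( *:%R : R -> V -> V)
  (scale_is_bilinear V).
pose s : {bilinear R -> V -> V} := HB.pack ( *:%R : R -> V -> V) sm.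
have cs : continuous (fun p : R * V => s p.1 p.2) by exact: scale_continuous.
pose p y := (a y, f y).
have -> : (fun y => a y *: f y) = (fun p : R * V => s p.1 p.2) \o p by [].
have dp : differentiable p x by exact: differentiable_pair.
have ds := differentiable_bilin (p x) cs.
apply: DiffDef; first exact: differentiable_comp.
by rewrite diff_comp// diff_bilin// diff_pair.
Qed.

Lemma CkG_scale U V k (O : set U) (a : U -> R) (f : U -> V) :
  open O -> CkG k O a -> CkG k O f -> CkG k O (fun x => a x *: f x).
Proof.
move=> oO; elim: k a f => [|k IH] a f.
  by move=> ca cf x Ox; apply: cvgZ; [exact: ca | exact: cf].
move=> ka kf; have ka' := CkGS ka; have kf' := CkGS kf.
move: ka kf => [da ka] [df kf]; split=> [x Ox|v].
  exact: (@ex_diff _ _ _ _ _ _ _ (is_diff_scale (da _ Ox) (df _ Ox))).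
apply: (@eq_CkG _ _ _ _ (fun x => a x *: 'd f x v + 'd a x v *: f x)) => //.
  move=> x /set_mem Ox.
  by rewrite (is_diff_val v (is_diff_scale (da _ Ox) (df _ Ox))).
by apply: CkGD => //; [exact: IH ka' (kf v) | exact: IH (ka v) kf'].
Qed.

Definition has_basis V :=
  exists m (e : 'I_m -> V) (l : 'I_m -> {linear V -> R}),
  (forall i, continuous (l i)) /\ forall v, v = \sum_(i < m) l i v *: e i.

Lemma has_basis_rV n : has_basis 'rV[R]_n.
Proof.
have lin i : linear (fun v : 'rV[R]_n => v 0 i) by move=> a u v; rewrite !mxE.
pose lm i := GRing.isLinear.Build _ _ _ _ _ (lin i).
pose l i : {linear 'rV[R]_n -> R} := HB.pack (fun v : 'rV[R]_n => v 0 i) (lm i).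
exists n, (fun i => delta_mx 0 i), l; split=> [i v|v].
  exact: coord_continuous.
by rewrite [LHS]row_sum_delta.
Qed.

Lemma has_basis_R : has_basis R.
Proof.
exists 1%N, (fun=> 1), (fun=> idfun); split=> [i x //|v].
by rewrite big_ord1 /= [_ *: _]mulr1.
Qed.

(** In the chain rule the direction ['d f x v] moves with [x], whereas [CkG] speaks of fixed
    directions. Expanding it in the basis [e] gives a sum of scalar C^k functions times
    ['d g (f x) (e i)], to which the induction hypothesis applies. *)
Lemma CkG_comp U V W k (O : set U) (O' : set V) (f : U -> V) (g : V -> W) :
  has_basis V -> open O -> open O' -> (forall x, O x -> O' (f x)) ->
  CkG k O f -> CkG k O' g -> CkG k O (g \o f).
Proof.
move=> [m [e [l [cl bV]]]] oO oO' fO; elim: k f g fO => [|k IH] f g fO.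
  by move=> cf cg x Ox; apply: continuous_comp; [exact: cf | exact/cg/fO].
move=> kf kg; have kf' := CkGS kf; move: kf kg => [df kf] [dg kg].
split=> [x Ox|v].
  by apply: differentiable_comp; [exact: df | exact/dg/fO].
apply: (@eq_CkG _ _ _ _
  (fun x => \sum_(i < m) l i ('d f x v) *: 'd g (f x) (e i))) => //.
  move=> x /set_mem Ox; have dfx := differentiableP (df _ Ox).
  have dgx := differentiableP (dg _ (fO _ Ox)).
  rewrite (is_diff_val v (is_diff_comp dfx dgx)) /=.
  rewrite [in RHS](bV ('d f x v)) linear_sum.
  by apply: eq_bigr => i _; rewrite linearZ.
apply: CkG_sum => // i; apply: CkG_scale => //; first exact: CkG_lcomp (kf v).
exact: (IH _ (fun y => 'd g y (e i)) fO kf' (kg (e i))).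
Qed.

End CkGen.

(** * Bump functions *)

Section Bump.
Context {R : realType}.

(** The powers of [t^-1] make the family stable under differentiation: the derivative of one member
    combines the next two, so a single induction on k, for all m at once, shows that all are
    smooth. *)
Definition flat (m : nat) (t : R) : R :=
  if 0 < t then t^-1 ^+ m * expR (- t^-1) else 0.

Lemma flat_le0 m t : t <= 0 -> flat m t = 0.
Proof. by rewrite /flat ltNge => ->. Qed.

Lemma flat_gt0 m t : 0 < t -> 0 < flat m t.
Proof.
by move=> t0; rewrite /flat t0 mulr_gt0 ?expR_gt0// exprn_gt0 ?invr_gt0.
Qed.

(** From exp s >= s^(m+2) / (m+2)! at s = 1/t. The two powers beyond m leave a bound quadratic in t,
    which forces the derivative at 0 to vanish. *)
Lemma flat_bound m t : `|flat m t| <= m.+2`!%:R * `|t| ^+ 2.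
Proof.
rewrite /flat; case: ifPn => [t0|_]; last by rewrite normr0 mulr_ge0.
rewrite ger0_norm ?(gtr0_norm t0); last first.
  by rewrite mulr_ge0 ?expR_ge0// exprn_ge0// invr_ge0 ltW.
have s0 : 0 < t^-1 by rewrite invr_gt0.
have := expR_ge1Dxn m.+1 (ltW s0).
rewrite expRN ler_pdivrMr ?expR_gt0// => es.
have {}es : t^-1 ^+ m.+2 / m.+2`!%:R <= expR t^-1.
  by apply: le_trans es; rewrite lerDr.
rewrite ler_pdivrMr ?ltr0n ?fact_gt0// in es.
have -> : t^-1 ^+ m = t^-1 ^+ m.+2 * t ^+ 2.
  by rewrite -addn2 exprD -mulrA -exprMn mulVf ?gt_eqF// expr1n mulr1.
rewrite [leRHS]mulrAC; apply: ler_wpM2r; first by rewrite exprn_ge0// ltW.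
by rewrite [leRHS]mulrC.
Qed.

Lemma is_derive_flat (m : nat) (t : R) :
  is_derive t 1 (flat m) (flat m.+2 t - m%:R * flat m.+1 t).
Proof.
have [t0|t0|t0] := ltgtP 0 t; last subst t.
- have nearE : \forall x \near t, x^-1 ^+ m * expR (- x^-1) = flat m x.
    by near=> x; rewrite /flat ifT//; near: x; exact: lt_nbhsr.
  apply: near_eq_is_derive nearE _.
  rewrite /flat t0.
  have dV : is_derive t 1 (fun x : R => x^-1) (- t^-1 ^+ 2).
    apply: is_derive_eq; first by apply: is_deriveV; rewrite gt_eqF.
    by rewrite [_ *: _]mulr1 -exprVn.
  have dE : is_derive t (1 : R) (fun x : R => expR (- x^-1))
      (t^-1 ^+ 2 * expR (- t^-1)).
    have := @is_derive1_comp R expR (fun x => - x^-1) t _ _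
      (is_derive_expR (- t^-1)) (is_deriveN dV).
    by rewrite opprK => h; exact: (is_derive_eq h (mulrC _ _)).
  have dX : is_derive t 1 (fun x : R => x^-1 ^+ m) (- m%:R * t^-1 ^+ m.+1).
    have h := is_deriveX m dV; rewrite exprfctE in h; apply: is_derive_eq h _.
    rewrite /GRing.scale /=; case: (m) => [|n] /=; first by ring.
    by rewrite !exprS; ring.
  have h := is_deriveM dX dE; rewrite mulrfctE in h; apply: is_derive_eq h _.
  rewrite /GRing.scale /= !exprS; ring.
- have nearE : \forall x \near t, 0 = flat m x.
    by near=> x; rewrite flat_le0//; apply: ltW; near: x; exact: lt_nbhsl.
  apply: near_eq_is_derive nearE _.
  by rewrite !flat_le0 ?mulr0 ?subr0 ?ltW//; exact: is_derive_cst.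
(* At 0 the bound C h^2 of [flat_bound] is below e |h| as soon as |h| <= e / C. *)
have d0 : is_diff (0 : R) (flat m) (\0 : {linear R -> R}).
  apply: is_diff_eps => [x|e e0]; first exact: cst_continuous.
  near=> h; rewrite /= !addr0 (@flat_le0 _ 0)// subr0.
  rewrite (le_trans (flat_bound _ _))// expr2 mulrA ler_wpM2r//.
  rewrite -ler_pdivlMl ?ltr0n ?fact_gt0//.
  near: h; apply: (@nbhs0_le _ R^o).
  by rewrite mulr_gt0// invr_gt0 ltr0n fact_gt0.
rewrite !flat_le0 ?mulr0 ?subr0//.
apply: DeriveDef.
  by apply/derivable1_diffP.
rewrite -derive1E derive1E'//.
by rewrite (is_diff_val (1 : R) d0).
Unshelve. all: by end_near.
Qed.

Lemma CkG_flat k m : CkG k setT (flat m).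
Proof.
elim: k m => [|k IH] m /=.
  move=> x _; apply: differentiable_continuous.
  by apply/derivable1_diffP; case: (is_derive_flat m x).
have df x : differentiable (flat m) x.
  by apply/derivable1_diffP; case: (is_derive_flat m x).
split=> // v.
have dE x : 'd (flat m) x v = v *: (flat m.+2 x + (- m%:R) *: flat m.+1 x).
  rewrite diff1E// derive1E; have [_ ->] := is_derive_flat m x.
  by rewrite /GRing.scale /= mulNr.
under eq_fun do rewrite dE.
have sc (a : R) (f : R -> R) : CkG k setT f -> CkG k setT (fun x => a *: f x).
  by move=> kf; apply: CkG_scale => //; [exact: openT | exact: CkG_cst].
by apply/sc/CkGD; [exact: openT | exact: IH | exact/sc/IH].
Qed.

(* flat 0 is positive exactly on ]0, +oo[, so [step t] vanishes when t <= 0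
   and equals 1 as soon as [flat 0 (1 / 2) <= flat 0 t]. *)
Definition step (t : R) : R :=
  1 - flat 0 (1 - flat 0 t / flat 0 2^-1) / flat 0 1.

Lemma step_le0 t : t <= 0 -> step t = 0.
Proof.
move=> t0; rewrite /step (flat_le0 _ t0) mul0r subr0 divff ?subrr//.
by rewrite gt_eqF ?flat_gt0.
Qed.

Lemma step_ge_half t : 2^-1 <= t -> step t = 1.
Proof.
move=> t0; rewrite /step (@flat_le0 _ (1 - _)) ?mul0r ?subr0//.
rewrite subr_le0 ler_pdivlMr ?flat_gt0// mul1r.
have h0 : (0 : R) < 2^-1 by rewrite invr_gt0.
have t1 : 0 < t by exact: lt_le_trans t0.
by rewrite /flat h0 t1 !expr0 !mul1r ler_expR lerN2 lef_pV2.
Qed.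

Lemma CkG_step k : CkG k setT step.
Proof.
have oT := @openT R.
have sc (a : R) (f : R -> R) : CkG k setT f -> CkG k setT (fun x => a *: f x).
  by move=> kf; apply: CkG_scale => //; exact: CkG_cst.
pose u t := 1 + (- (flat 0 2^-1)^-1) *: flat 0 t.
have ku : CkG k setT u.
  by apply: CkGD => //; [exact: CkG_cst | exact/sc/CkG_flat].
have kw : CkG k setT (flat 0 \o u).
  by apply: (CkG_comp has_basis_R oT oT) ku _ => //; exact: CkG_flat.
have -> : step = (fun t => 1 + (- (flat 0 1)^-1) *: (flat 0 \o u) t).
  apply/funext => t; rewrite /step /u /GRing.scale /= !mulNr.
  by rewrite (mulrC _ (flat 0 t)) (mulrC _^-1).
by apply: CkGD => //; [exact: CkG_cst | exact: sc].
Qed.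
End Bump.

(** * Gluing C^r extensions *)

Section Gluing.
Context {R : realType}.

(** For [rho > 0] it is nonnegative exactly on the closed Euclidean ball. The Euclidean square is
    polynomial, hence smooth, unlike the sup norm carried by row vectors. *)
Definition quad {n} (c : 'rV[R]_n) (rho : R) (x : 'rV[R]_n) : R :=
  1 - \sum_(i < n) ((x 0 i - c 0 i) / rho) ^+ 2.

Lemma CkG_quad n k (c : 'rV[R]_n) rho : CkG k setT (quad c rho).
Proof.
have oT := @openT 'rV[R]_n.
have kc i : CkG k setT (fun x : 'rV[R]_n => x 0 i).
  have lin : linear (fun v : 'rV[R]_n => v 0 i) by move=> a u v; rewrite !mxE.
  pose lm := GRing.isLinear.Build _ _ _ _ _ lin.
  pose l : {linear 'rV[R]_n -> R} := HB.pack (fun v : 'rV[R]_n => v 0 i) lm.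
  apply: (@CkG_linear _ _ _ _ _ l) => x; exact: coord_continuous.
pose u i (x : 'rV[R]_n) := rho^-1 *: (x 0 i + - c 0 i).
have ku i : CkG k setT (u i).
  apply: CkG_scale => //; first exact: CkG_cst.
  by apply: CkGD => //; exact: CkG_cst.
have -> : quad c rho = fun x => 1 + -1 *: \sum_(i < n) (u i x *: u i x).
  apply/funext => x; rewrite /quad scaleN1r; congr (1 - _).
  by apply: eq_bigr => i _; rewrite expr2 /u /GRing.scale /= !(mulrC rho^-1).
apply: CkGD => //; first exact: CkG_cst.
apply: CkG_scale => //; first exact: CkG_cst.
by apply: CkG_sum => // i; exact: CkG_scale.
Qed.

Lemma quad_cont n (c : 'rV[R]_n) rho : continuous (quad c rho).
Proof. by move=> x; exact: (CkG_quad 0). Qed.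

Lemma quad_ge0 n (c : 'rV[R]_n) rho x i : 0 < rho -> 0 <= quad c rho x ->
  `|x 0 i - c 0 i| <= rho.
Proof.
move=> rho0; rewrite subr_ge0 (bigD1 i)//= => qx.
have : ((x 0 i - c 0 i) / rho) ^+ 2 <= 1.
  by apply: le_trans qx; rewrite lerDl sumr_ge0// => j _; exact: sqr_ge0.
rewrite -real_normK ?num_real// expr_le1// normrM normfV (gtr0_norm rho0).
by rewrite ler_pdivrMr// mul1r.
Qed.

(** It equals 1 where [quad] is at least 1/2 and 0 where [quad] is at most 0. *)
Definition bump {n} (c : 'rV[R]_n) (rho : R) : 'rV[R]_n -> R :=
  step \o quad c rho.

Lemma CkG_bump n k (c : 'rV[R]_n) rho : CkG k setT (bump c rho).
Proof.
apply: (CkG_comp has_basis_R) (CkG_quad k c rho) (CkG_step k) => //.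
  exact: openT.
exact: openT.
Qed.

(** Extension by zero: [O] contains the closed set [0 <= quad], so [O] and the open set [quad < 0],
    where the product vanishes, cover the space. *)
Lemma CkG_bump_scale n m k (c : 'rV[R]_n) rho (O : set 'rV[R]_n)
    (F : 'rV[R]_n -> 'rV[R]_m) :
  open O -> (forall x, 0 <= quad c rho x -> O x) -> CkG k O F ->
  CkG k setT (fun x => bump c rho x *: F x).
Proof.
move=> oO qO kF; apply: CkG_local => x _.
have [q0|q0] := leP 0 (quad c rho x).
  exists O; first exact: qO.
  by apply: CkG_scale => //; exact: sub_CkG (CkG_bump k c rho).
exists (quad c rho @^-1` [set t | t < 0]) => //.
have oN : open (quad c rho @^-1` [set t | t < 0]).
  by apply: open_comp; [move=> y _; exact: quad_cont | exact: open_lt].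
apply: (@eq_CkG _ _ _ _ _ (fun=> 0)) => //; last exact: CkG_cst.
by move=> y /set_mem /= qy; rewrite /bump /= step_le0 ?scale0r// ltW.
Qed.

(** Rational centres and radii make the balls countable. The strict bound 1/2 persists near [z], so
    the bump is 1 on a neighbourhood of [z]. *)
Lemma rat_quad n (O : set 'rV[R]_n) z : open O -> O z ->
  exists (c : 'rV[rat]_n) (rho : rat),
    2^-1 < quad (map_mx ratr c) (ratr rho) z /\
    forall x, 0 <= quad (map_mx ratr c) (ratr rho) x -> O x.
Proof.
rewrite openE => /[apply] /nbhs_ballP[e /= e0 eO].
have [rho] : exists rho : rat, ratr rho \in `]0, e / 2[%R.
  by apply: rat_in_itvoo; rewrite divr_gt0.
rewrite in_itv /= => /andP[rho0 rhoe].
(* With this [d] each normalised coordinate is at most 1/(2(n+1)), and so is its square; the n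
   squares add up to less than 1/2, also when n = 0. As [d <= rho < e / 2], a point within [rho] of
   the centre in each coordinate is within [e] of [z]. *)
set d : R := ratr rho / (2 * n.+1%:R).
have d0 : 0 < d by rewrite divr_gt0.
have drho : d <= ratr rho.
  by rewrite ler_pdivrMr// ler_peMr ?(ltW rho0)// -natrM ler1n.
have /choice[c cP] (i : 'I_n) :
    exists q : rat, ratr q \in `]z 0 i - d, z 0 i + d[%R.
  by apply: rat_in_itvoo; lra.
have zc i : `|z 0 i - ratr (c i)| < d.
  by move: (cP i); rewrite in_itv /= ltr_norml => ?; lra.
exists (\row_i c i), rho; split.
  rewrite /quad.
  have : \sum_(i < n)
      ((z 0 i - (map_mx ratr (\row_j c j)) 0 i) / ratr rho) ^+ 2
     <= \sum_(i < n) (2 * n.+1%:R)^-1 :> R.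
    apply: ler_sum => i _; rewrite !mxE.
    have h : `|(z 0 i - ratr (c i)) / ratr rho| <= (2 * n.+1%:R)^-1.
      rewrite normrM normfV (gtr0_norm rho0) ler_pdivrMr//.
      by rewrite mulrC ltW.
    rewrite -real_normK ?num_real// expr2.
    apply: le_trans (_ : 1 * (2 * n.+1%:R)^-1 <= _); last by rewrite mul1r.
    apply: ler_pM => //; apply: le_trans h _.
    by rewrite invf_le1// -natrM ler1n.
  rewrite sumr_const card_ord -[leRHS]mulr_natl => hs.
  have : n%:R * (2 * n.+1%:R)^-1 < 2^-1 :> R.
    by rewrite invfM mulrCA gtr_pMr// ltr_pdivrMr// mul1r ltr_nat.
  move=> /(le_lt_trans hs); move: (\sum_(i < n) _) => s; lra.
move=> x qx; apply: eO; rewrite /ball /= /mx_ball; split=> // i j.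
rewrite ord1 -ball_normE /=.
have := quad_ge0 j rho0 qx; rewrite !mxE => xc; have zcj := zc j.
by move: xc zcj; rewrite !ler_norml !ltr_norml => ? ?; lra.
Qed.

(* The cutoffs are processed in turn with partial products of [1 - h j]: the
   sums [\sum_(i < j) (\prod_(l < i) (1 - h l)) *: H i] are stationary wherever
   some [h j] equals 1, so that no local finiteness is needed. *)
Lemma glue_countable n m r (P : set 'rV[R]_n) (G : 'rV[R]_n -> 'rV[R]_m)
    (h : nat -> 'rV[R]_n -> R) (H : nat -> 'rV[R]_n -> 'rV[R]_m) :
  (forall j k, le_smoothness k r -> CkG k setT (h j) /\ CkG k setT (H j)) ->
  (forall j z, P z -> H j z = h j z *: G z) ->
  (forall z, P z -> exists j, \forall x \near z, h j x = 1) ->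
  exists (O : set 'rV[R]_n) (F : 'rV[R]_n -> 'rV[R]_m),
    [/\ open O, P `<=` O, Cr_open r O F & forall z, P z -> F z = G z].
Proof.
move=> hk HG hP; have oT := @openT 'rV[R]_n.
pose p j x := \prod_(i < j) (1 - h i x).
pose S j x := \sum_(i < j) p i x *: H i x.
(* The sum telescopes: on [P] the i-th term is [p i z - p i.+1 z] times [G z]. *)
have SG j z : P z -> S j z = (1 - p j z) *: G z.
  move=> Pz; elim: j => [|j IH]; first by rewrite /S /p !big_ord0 subrr scale0r.
  rewrite /S big_ord_recr /= -/(S j z) IH HG// scalerA -scalerDl.
  congr (_ *: _).
  by rewrite [in RHS]/p big_ord_recr /= -/(p j z); ring.
have kp j k : le_smoothness k r -> CkG k setT (p j).
  move=> kr; elim: j => [|j IH].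
    rewrite (_ : p 0%N = fun=> 1); first exact: CkG_cst.
    by apply/funext => x; rewrite /p big_ord0.
  rewrite (_ : p j.+1 = fun x => p j x *: (1 + -1 *: h j x)).
    apply: CkG_scale => //; apply: CkGD => //; first exact: CkG_cst.
    by apply: CkG_scale => //; [exact: CkG_cst | have [] := hk j k kr].
  by apply/funext => x; rewrite /p big_ord_recr /= scaleN1r.
have kS j k : le_smoothness k r -> CkG k setT (S j).
  move=> kr; apply: CkG_sum => // i; apply: CkG_scale => //; first exact: kp.
  by have [] := hk i k kr.
have p0 i j x : h i x = 1 -> (i < j)%N -> p j x = 0.
  by move=> hx ij; rewrite /p (bigD1 (Ordinal ij))//= hx subrr mul0r.
have SE i j x : h i x = 1 -> (i <= j)%N -> S j.+1 x = S i.+1 x.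
  move=> hx /subnK <-; elim: (j - i)%N => // d IH.
  rewrite addSn /S big_ord_recr /= -/(S _ x) IH (@p0 i) ?scale0r ?addr0//.
  by rewrite ltnS leq_addl.
(* By [SE] every index with [h j x = 1] gives the same value. The successor is needed because the
   factor [1 - h j x] enters the product only at [p j.+1]. *)
pose F x := S (get [set j | h j x = 1]).+1 x.
have FE j x : h j x = 1 -> F x = S j.+1 x.
  move=> hx; rewrite /F; case: xgetP => [i _ /= hi|/(_ j)//].
  by case: (leqP i j) => [|/ltnW] ij; [rewrite (SE i j)|rewrite (SE j i)].
exists (\bigcup_j [set x | h j x = 1]°), F; split.
- by apply: bigcup_open => j _; exact: open_interior.
- by move=> z /hP[j hj]; exists j.
- move=> k kr; apply/CkGE; apply: CkG_local => x [j _ hx].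
  exists [set x | h j x = 1]° => //.
  apply: (@eq_CkG _ _ _ _ _ (S j.+1)); first exact: open_interior.
    by move=> y /set_mem /interior_subset /= hy; rewrite (FE j).
  exact: sub_CkG (kS _ _ kr).
move=> z Pz; have [j /nbhs_singleton hz] := hP z Pz.
by rewrite (FE j)// SG// (@p0 j)// subr0 scale1r.
Qed.

(** A rational ball is good when it fits inside the domain of some local extension. Each good ball
    yields a bump and a cut-off extension, and [pickle] turns the countable family into the sequence
    required by [glue_countable]. *)
Lemma Cr_glue n m r (P : set 'rV[R]_n) (G : 'rV[R]_n -> 'rV[R]_m) :
  (forall z, P z -> exists (O : set 'rV[R]_n) (F : 'rV[R]_n -> 'rV[R]_m),
    [/\ open O, O z, Cr_open r O F & forall y, P y -> O y -> F y = G y]) ->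
  exists (O : set 'rV[R]_n) (F : 'rV[R]_n -> 'rV[R]_m),
    [/\ open O, P `<=` O, Cr_open r O F & forall z, P z -> F z = G z].
Proof.
move=> PG.
pose q (a : 'rV[rat]_n * rat) := quad (map_mx (@ratr R) a.1) (ratr a.2).
pose good (a : 'rV[rat]_n * rat) :=
  exists (O : set 'rV[R]_n) (F : 'rV[R]_n -> 'rV[R]_m),
  [/\ open O, Cr_open r O F, (forall x, 0 <= q a x -> O x)
    & forall y, P y -> O y -> F y = G y].
have /choice[hH hHP] (j : nat) :
  exists hH : ('rV[R]_n -> R) * ('rV[R]_n -> 'rV[R]_m),
    [/\ forall k, le_smoothness k r -> CkG k setT hH.1 /\ CkG k setT hH.2,
        forall z, P z -> hH.2 z = hH.1 z *: G z
      & forall a, unpickle j = Some a -> good a ->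
          forall x, 2^-1 <= q a x -> hH.1 x = 1].
  have [[a [ja [ O [F [oO rF qO FG]]]]]|bad] :=
      pselect (exists a, unpickle j = Some a /\ good a).
    pose b := bump (map_mx ratr a.1) (ratr a.2).
    exists (b, fun x => b x *: F x); split => /=.
    - move=> k kr; split; first exact: CkG_bump.
      by apply: (CkG_bump_scale oO qO); apply/CkGE; exact: rF.
    - move=> z Pz; have [q0|q0] := leP 0 (q a z).
        by rewrite FG//; exact: qO.
      by rewrite /b /bump /= step_le0 ?scale0r// ltW.
    - by move=> a'; rewrite ja => -[<-] _ x qx; exact: step_ge_half.
  (* An index that codes no good ball contributes a zero cutoff and a zero map. *)
  exists (fun=> 0, fun=> 0); split => /=.
  - by move=> k _; split; exact: CkG_cst.
  - by move=> z _; rewrite scale0r.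
  - by move=> a ja ga; case: bad; exists a.
apply: (@glue_countable n m r P G (fun j => (hH j).1) (fun j => (hH j).2)).
- by move=> j; have [] := hHP j.
- by move=> j; have [] := hHP j.
move=> z /PG[ O [F [oO Oz rF FG]]].
have [c [rho [qz qO]]] := rat_quad oO Oz.
exists (pickle (c, rho)); have [_ _] := hHP (pickle (c, rho)).
move=> /(_ (c, rho)); rewrite pickleK => /(_ erefl) hq.
have {}hq := hq (ex_intro _ O (ex_intro _ F (And4 oO rF qO FG))).
near=> x; apply: hq; apply: ltW; near: x.
apply: (@quad_cont _ (map_mx ratr c) (ratr rho) z
  [set t | 2^-1 < t]).
exact: lt_nbhsr.
Unshelve. all: by end_near.
Qed.

End Gluing.

(** * C^r maps in charts *)

Section CrRep.
Context {R : realType} (r : smoothness).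

Lemma Cr_rep_sub T n m (S S' : set T) (p : T -> 'rV[R]_n) (q : T -> 'rV[R]_m) :
  S' `<=` S -> Cr_rep r S p q -> Cr_rep r S' p q.
Proof.
move=> sS [ O [F [oO pO rF FE]]].
exists O, F; split=> // [|x /sS]; last exact: FE.
by apply: subset_trans pO; exact: image_subset.
Qed.

Lemma Cr_rep_id T n (S : set T) (p : T -> 'rV[R]_n) : Cr_rep r S p p.
Proof.
exists setT, idfun; split=> //; first exact: openT.
by move=> k _; apply/CkGE; apply: CkG_linear => x; exact: cvg_id.
Qed.

Lemma Cr_rep_comp T n m l (S : set T) (p : T -> 'rV[R]_n) (q : T -> 'rV[R]_m)
    (s : T -> 'rV[R]_l) :
  Cr_rep r S p q -> Cr_rep r S q s -> Cr_rep r S p s.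
Proof.
move=> [ O [F [oO pO rF FE]]] [ O' [F' [oO' qO' rF' FE']]].
have F0 : forall x, O x -> {for x, continuous F} by apply: (rF 0); case: (r).
exists (O `&` F @^-1` O'), (F' \o F); split.
- move: oO; rewrite !openE => oO x [Ox /= O'x].
  by apply: filterI; [exact: oO | apply: F0 => //; exact: open_nbhs_nbhs].
- move=> _ [x Sx <-]; split; first by apply: pO; exists x.
  by rewrite /= FE//; apply: qO'; exists x.
- move=> k kr; apply/CkGE.
  have oI : open (O `&` F @^-1` O').
    move: oO; rewrite !openE => oO x [Ox /= O'x].
    by apply: filterI; [exact: oO | apply: F0 => //; exact: open_nbhs_nbhs].
  apply: (CkG_comp (has_basis_rV m) oI oO') => [x [] //||].
    by apply: (@sub_CkG _ _ _ _ O) => //; apply/CkGE; exact: rF.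
  by apply/CkGE; exact: rF'.
by move=> x Sx; rewrite /= FE// FE'.
Qed.

Lemma Cr_rep_pre T T' n m (k : T' -> T) (S : set T) (p : T -> 'rV[R]_n)
    (q : T -> 'rV[R]_m) :
  Cr_rep r S p q -> Cr_rep r (k @^-1` S) (p \o k) (q \o k).
Proof.
move=> [ O [F [oO pO rF FE]]]; exists O, F; split=> // [|x Sx]; last exact: FE.
by move=> _ [x Sx <-]; apply: pO; exists (k x).
Qed.

Lemma Cr_rep_img T T' n m (k : T' -> T) (S : set T') (p : T -> 'rV[R]_n)
    (q : T -> 'rV[R]_m) :
  Cr_rep r S (p \o k) (q \o k) -> Cr_rep r (k @` S) p q.
Proof.
move=> [ O [F [oO pO rF FE]]]; exists O, F; split=> //.
  by move=> _ [_ [x Sx <-] <-]; apply: pO; exists x.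
by move=> _ [x Sx <-]; exact: FE.
Qed.

(** A chart is an open embedding into a cone, so local extensions on neighbourhoods in M become
    local extensions around points of the image of [S], where [Cr_glue] applies. *)
Lemma Cr_rep_local (M : topologicalType) (c : chart R M) m (S : set M)
    (q : M -> 'rV[R]_m) :
  is_chart c -> S `<=` chart_dom c ->
  (forall x, S x ->
     exists N, [/\ open N, N x & Cr_rep r (S `&` N) (chart_map c) q]) ->
  Cr_rep r S (chart_map c) q.
Proof.
move=> [oc [k [f [_ cf cinj _ cimg]]]] Sc SN.
have cI x y : S x -> chart_dom c y -> chart_map c x = chart_map c y -> x = y.
  by move=> /Sc xc yc; apply: cinj; exact/mem_set.
(* [G] is [q] read in the chart, well defined by injectivity; its value 0 off the image of [S] is
   arbitrary. *)
have /choice[G GP] y : exists w, forall x, S x -> chart_map c x = y -> q x = w.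
  have [[x [Sx xy]]|nx] := pselect (exists x, S x /\ chart_map c x = y).
    by exists (q x) => x' Sx' x'y; congr q; apply: cI; rewrite ?xy//; exact: Sc.
  by exists 0 => x Sx xy; case: nx; exists x.
have [|O [F [oO pO rF FE]]] := @Cr_glue R _ _ r (chart_map c @` S) G.
  move=> _ [x Sx <-]; have [N [oN Nx [ O [F [oO pO rF FE]]]]] := SN x Sx.
  (* Intersecting with [B] ensures that image points in the new domain come from points of [N],
     where [F] is known to represent [q]. *)
  have [|B oB BE] := cimg (N `&` chart_dom c) (openI oN oc).
    by move=> ? [].
  have Bc y : S y -> N y -> B (chart_map c y).
    move=> Sy Ny; have : (chart_map c @` (N `&` chart_dom c)) (chart_map c y).
      by exists y => //; split=> //; exact: Sc.
    by rewrite BE => -[].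
  exists (O `&` B), F; split; first exact: openI.
  - by split; [apply: pO; exists x | exact: Bc].
  - move=> j jr; apply/CkGE; apply: (@sub_CkG _ _ _ _ O); first by move=> ? [].
    by apply/CkGE; exact: rF.
  move=> _ [y Sy <-] [_ By].
  have : (chart_map c @` (N `&` chart_dom c)) (chart_map c y).
    by rewrite BE; split=> //; apply: cf; exact: Sc.
  move=> [z [Nz cz] zy]; have yz := cI y z Sy cz (esym zy).
  by rewrite (FE y); [exact: GP | split=> //; rewrite yz].
by exists O, F; split=> // x Sx; rewrite FE; [rewrite -(GP _ x)|exists x].
Qed.

End CrRep.

(** * Being C^r at a point, and restriction to open subsets *)

Section CrAt.
Context {R : realType} (r : smoothness).

(* [v] is a C^r function of [u] near [t], in the charts of [A] and [B]; the
   restriction of a diffeomorphism to an open set [U] corresponds to taking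
   for [u] the inclusion of [U]. *)
Definition Cr_at {T X Y : topologicalType} (A : set (chart R X))
    (B : set (chart R Y)) (u : T -> X) (v : T -> Y) (t : T) : Prop :=
  exists c, A c /\ exists d, B d /\ exists N,
    [/\ open N, N t, forall s, N s -> chart_dom c (u s) /\ chart_dom d (v s)
      & Cr_rep r N (chart_map c \o u) (chart_map d \o v)].

Lemma Cr_at_refl (T X : topologicalType) (A : set (chart R X)) (u : T -> X) t :
  Cr_atlas r A -> continuous u -> Cr_at A A u u t.
Proof.
move=> [Ac Acov _] cu; have : setT (u t) by [].
rewrite -Acov => -[c Acc cut]; exists c; split=> //; exists c; split=> //.
exists (u @^-1` chart_dom c); split=> //; last exact: Cr_rep_id.
by apply: open_comp; [move=> x _; exact: cu | exact: (Ac c Acc).1].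
Qed.

Lemma Cr_at_trans (T X Y Z : topologicalType) (A : set (chart R X))
    (B : set (chart R Y)) (C : set (chart R Z)) (u : T -> X) (v : T -> Y)
    (w : T -> Z) t :
  Cr_atlas r B -> Cr_at A B u v t -> Cr_at B C v w t -> Cr_at A C u w t.
Proof.
move=> [_ _ Bcomp] [c [Ac [d [Bd [N [oN Nt Ncd rN]]]]]].
move=> [d' [Bd' [e [Ce [N' [oN' N't N'de rN']]]]]].
exists c; split=> //; exists e; split=> //; exists (N `&` N'); split=> //.
- exact: openI.
- by move=> s [/Ncd[? _] /N'de[_ ?]].
apply: Cr_rep_comp (Cr_rep_sub _ rN) _; first by move=> ? [].
apply: Cr_rep_comp _ (Cr_rep_sub _ rN'); last by move=> ? [].
have [dd' _] := Bcomp d d' Bd Bd'.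
by apply: Cr_rep_sub (Cr_rep_pre v dd') => s [/Ncd[_ ?] /N'de[? _]].
Qed.

Lemma Cr_at_pre (T T' X Y : topologicalType) (A : set (chart R X))
    (B : set (chart R Y)) (u : T -> X) (v : T -> Y) (k : T' -> T) t :
  continuous k -> Cr_at A B u v (k t) -> Cr_at A B (u \o k) (v \o k) t.
Proof.
move=> ck [c [Ac [d [Bd [N [oN Nt Ncd rN]]]]]].
exists c; split=> //; exists d; split=> //; exists (k @^-1` N); split=> //.
- by apply: open_comp => // x _; exact: ck.
- by move=> s /Ncd.
by move/(Cr_rep_pre k): rN.
Qed.

(** Applied to the inclusion of an open subset, it lets a property at a point of M be checked inside
    that subset. *)
Lemma Cr_at_img (T T' X Y : topologicalType) (A : set (chart R X))
    (B : set (chart R Y)) (u : T -> X) (v : T -> Y) (k : T' -> T) t :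
  (forall N, open N -> open (k @` N)) ->
  Cr_at A B (u \o k) (v \o k) t -> Cr_at A B u v (k t).
Proof.
move=> ok [c [Ac [d [Bd [N [oN Nt Ncd rN]]]]]].
exists c; split=> //; exists d; split=> //; exists (k @` N); split.
- exact: ok.
- by exists t.
- by move=> _ [s Ns <-]; exact: Ncd.
by apply: (@Cr_rep_img _ _ _ _ _ _ k).
Qed.

(** One pair of charts around each point suffices: changes of charts on both sides reach any other
    pair, and [Cr_rep_local] assembles the local extensions. *)
Lemma Cr_mapP (X Y : topologicalType) (A : set (chart R X))
    (B : set (chart R Y)) (f : X -> Y) : Cr_atlas r A -> Cr_atlas r B ->
  Cr_map r A B f <-> continuous f /\ forall x, Cr_at A B id f x.
Proof.
move=> [Ac Acov Acomp] [Bc Bcov Bcomp]; split=> -[cf fAB]; split=> //.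
  move=> x; have : setT x by []. rewrite -Acov => -[c Acc cx].
  have : setT (f x) by []. rewrite -Bcov => -[d Bd dfx].
  exists c; split=> //; exists d; split=> //.
  exists (chart_dom c `&` f @^-1` chart_dom d); split=> //.
    apply: openI; first exact: (Ac c Acc).1.
    by apply: open_comp; [move=> y _; exact: cf | exact: (Bc d Bd).1].
  exact: fAB.
move=> c d Acc Bd; apply: Cr_rep_local; [exact: Ac|by move=> ? []|].
move=> x [cx dfx]; have [c' [Ac' [d' [Bd' [N [oN Nx Ncd rN]]]]]] := fAB x.
exists N; split=> //.
have [cc' _] := Acomp c c' Acc Ac'; have [dd' _] := Bcomp d' d Bd' Bd.
apply: Cr_rep_comp (Cr_rep_sub _ cc') _.
  by move=> y [[? _] /Ncd[]].
apply: Cr_rep_comp (Cr_rep_sub _ rN) _; first by move=> ? [].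
by apply: Cr_rep_sub (Cr_rep_pre f dd') => y [[_ ?] /Ncd[]].
Qed.

Lemma Cr_at_restrl (T M Y : topologicalType) (U : set M) (A : set (chart R M))
    (B : set (chart R Y)) (u : T -> U) (v : T -> Y) t :
  Cr_at (atlas_restr U A) B u v t <-> Cr_at A B (set_val \o u) v t.
Proof.
split=> [[_ [[c Ac <-] uv]]|[c [Ac uv]]]; first by exists c.
by exists (chart_restr U c); split=> //; exists c.
Qed.

Lemma Cr_at_restrr (T X M : topologicalType) (V : set M) (A : set (chart R X))
    (B : set (chart R M)) (u : T -> X) (v : T -> V) t :
  Cr_at A (atlas_restr V B) u v t <-> Cr_at A B u (set_val \o v) t.
Proof.
split=> -[c [Ac [d [Bd uv]]]]; exists c; split=> //.
  by case: Bd uv => d' Bd' <- uv; exists d'.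
by exists (chart_restr V d); split=> //; exists d.
Qed.

Lemma set_val_continuous (M : topologicalType) (U : set M) :
  continuous (set_val : U -> M).
Proof. exact: initial_continuous. Qed.

Lemma set_val_open (M : topologicalType) (U : set M) (N : set U) :
  open U -> open N -> open ((set_val : U -> M) @` N).
Proof.
move=> oU [S oS <-].
suff -> : (set_val : U -> M) @` (set_val @^-1` S) = U `&` S.
  exact: openI.
apply/seteqP; split=> [_ [x Sx <-]|x [Ux Sx]].
  by split=> //; exact: set_valP.
by exists (exist _ x (mem_set Ux)).
Qed.

Lemma atlas_restr_atlas (M : topologicalType) (U : set M)
    (A : set (chart R M)) :
  open U -> Cr_atlas r A -> Cr_atlas r (atlas_restr U A).
Proof.
move=> oU [Ac Acov Acomp]; split.
- move=> _ [c Acc <-]; have [oc [k [f [f0 cf cinj cc cimg]]]] := Ac c Acc.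
  split.
    by apply: open_comp => // x _; exact: set_val_continuous.
  exists k, f; split.
  + exact: f0.
  + by move=> x; exact: cf.
  + move=> x y /set_mem xc /set_mem yc xy; apply: val_inj.
    by apply: cinj xy; exact/mem_set.
  + move=> x xc; apply: continuous_comp; first exact: set_val_continuous.
    exact: cc.
  + move=> N oN Nc; have [|B oB BE] := cimg _ (set_val_open oU oN).
      by move=> _ [x /Nc xc <-].
    by exists B => //; rewrite -BE -image_comp.
- apply/seteqP; split=> // x _; have : setT (set_val x : M) by [].
  by rewrite -Acov => -[c Acc cx]; exists (chart_restr U c) => //; exists c.
- move=> _ _ [c Acc <-] [d Ad <-]; have [cd dc] := Acomp c d Acc Ad.
  pose i : U -> M := set_val.
  by split; [move/(Cr_rep_pre i): cd | move/(Cr_rep_pre i): dc].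
Qed.

End CrAt.

(** * Structures and diffeomorphisms *)

Section Structures.
Context {R : realType} (r : smoothness).

Lemma structure_of_atlas (M : topologicalType) (Q : set (chart R M)) :
  Cr_atlas r Q -> exists2 S, Cr_structure r S & Q `<=` S.
Proof.
move=> [Qc Qcov Qcomp].
pose S := [set c : chart R M |
  is_chart c /\ forall d, Q d -> Cr_compatible r c d].
have QS : Q `<=` S by move=> c Qc'; split; [exact: Qc | move=> d; exact: Qcomp].
(* Two charts of [S] are compared near each point through a chart of [Q] there. *)
have SS c c' : S c -> S c' ->
    Cr_rep r (chart_dom c `&` chart_dom c') (chart_map c) (chart_map c').
  move=> [cc cQ] [cc' c'Q]; apply: Cr_rep_local => // x [cx c'x].
  have : setT x by []. rewrite -Qcov => -[d Qd dx].
  exists (chart_dom d); split=> //; first exact: (Qc d Qd).1.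
  apply: Cr_rep_comp (Cr_rep_sub _ (cQ d Qd).1) (Cr_rep_sub _ (c'Q d Qd).2).
  - by move=> y [[? _] ?].
  - by move=> y [[_ ?] ?].
exists S => //; split.
  split=> [c []//||c c' Sc Sc'].
  - apply/seteqP; split=> // x _; have : setT x by [].
    by rewrite -Qcov => -[d /QS Sd dx]; exists d.
  - by split; [|rewrite setIC]; exact: SS.
move=> A' [A'c _ A'comp] SA'; apply/seteqP; split=> // c A'c'; split.
  exact: A'c.
by move=> d /QS/SA' A'd; exact: A'comp.
Qed.

(** Relating two maps out of a common space makes the notion symmetric and transitive, so pieces of
    diffeomorphisms can be chained without naming their inverses. *)
Definition Cr_iso {T X Y : topologicalType} (A : set (chart R X))
    (B : set (chart R Y)) (u : T -> X) (v : T -> Y) (t : T) : Prop :=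
  Cr_at r A B u v t /\ Cr_at r B A v u t.

Lemma Cr_iso_refl (T X : topologicalType) (A : set (chart R X)) (u : T -> X) t :
  Cr_atlas r A -> continuous u -> Cr_iso A A u u t.
Proof. by move=> atA cu; split; exact: Cr_at_refl. Qed.

Lemma Cr_iso_sym (T X Y : topologicalType) (A : set (chart R X))
    (B : set (chart R Y)) (u : T -> X) (v : T -> Y) t :
  Cr_iso A B u v t -> Cr_iso B A v u t.
Proof. by case. Qed.

Lemma Cr_iso_trans (T X Y Z : topologicalType) (A : set (chart R X))
    (B : set (chart R Y)) (C : set (chart R Z)) (u : T -> X) (v : T -> Y)
    (w : T -> Z) t :
  Cr_atlas r B -> Cr_iso A B u v t -> Cr_iso B C v w t -> Cr_iso A C u w t.
Proof.
move=> atB [uv vu] [vw wv].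
by split; [exact: Cr_at_trans uv vw | exact: Cr_at_trans wv vu].
Qed.

Lemma Cr_iso_pre (T T' X Y : topologicalType) (A : set (chart R X))
    (B : set (chart R Y)) (u : T -> X) (v : T -> Y) (k : T' -> T) t :
  continuous k -> Cr_iso A B u v (k t) -> Cr_iso A B (u \o k) (v \o k) t.
Proof. by move=> ck [uv vu]; split; exact: Cr_at_pre. Qed.

Lemma Cr_iso_img (T T' X Y : topologicalType) (A : set (chart R X))
    (B : set (chart R Y)) (u : T -> X) (v : T -> Y) (k : T' -> T) t :
  (forall N, open N -> open (k @` N)) ->
  Cr_iso A B (u \o k) (v \o k) t -> Cr_iso A B u v (k t).
Proof. by move=> ok [uv vu]; split; exact: Cr_at_img. Qed.

Lemma Cr_iso_restr (T M N : topologicalType) (U : set M) (V : set N)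
    (A : set (chart R M)) (B : set (chart R N)) (u : T -> U) (v : T -> V) t :
  Cr_iso (atlas_restr U A) (atlas_restr V B) u v t <->
  Cr_iso A B (set_val \o u) (set_val \o v) t.
Proof.
by rewrite /Cr_iso !Cr_at_restrl !Cr_at_restrr.
Qed.

(** Precomposing with [f] moves the condition on the inverse from [f x] to [x]. *)
Lemma Cr_diffeoP (X Y : topologicalType) (A : set (chart R X))
    (B : set (chart R Y)) (f : homeo X Y) : Cr_atlas r A -> Cr_atlas r B ->
  Cr_diffeo r A B f <-> forall x, Cr_iso A B id f x.
Proof.
move=> atA atB; rewrite /Cr_diffeo /=.
rewrite (Cr_mapP f atA atB) (Cr_mapP (hinv f) atB atA).
have fK : hinv f \o f = id by apply/funext => x; exact: hfunK.
have f'K : f \o hinv f = id by apply/funext => x; exact: hinvK.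
split=> [[[_ AB] [_ BA]] x|iso].
  split=> //; have := Cr_at_pre (@hfun_cont _ _ f) (BA (f x)).
  by rewrite fK.
split; (split; first by [exact: hfun_cont | exact: hinv_cont]).
  by move=> x; exact: (iso x).1.
move=> y; have := Cr_at_pre (@hinv_cont _ _ f) (iso (hinv f y)).2.
by rewrite f'K.
Qed.

Lemma Cr_diffeo_restrP (M : topologicalType) (X Y : set M) (A : set (chart R M))
    (f : homeo X Y) : Cr_atlas r A -> open X -> open Y ->
  Cr_diffeo r (atlas_restr X A) (atlas_restr Y A) f <->
  forall x, Cr_iso A A (set_val : X -> M) (set_val \o f) x.
Proof.
move=> atA oX oY; rewrite Cr_diffeoP; try exact: atlas_restr_atlas.
by split=> iso x; apply/Cr_iso_restr/iso.
Qed.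

Lemma Cr_diffeo_id (X : topologicalType) (A : set (chart R X)) :
  Cr_atlas r A -> Cr_diffeo r A A (homeo_id X).
Proof.
move=> atA; apply/Cr_diffeoP => // x; apply: Cr_iso_refl => // y.
exact: cvg_id.
Qed.

Lemma Cr_diffeo_inv (X Y : topologicalType) (A : set (chart R X))
    (B : set (chart R Y)) (f : homeo X Y) :
  Cr_diffeo r A B f -> Cr_diffeo r B A (homeo_inv f).
Proof. by case. Qed.

Lemma Cr_diffeo_comp (X Y Z : topologicalType) (A : set (chart R X))
    (B : set (chart R Y)) (C : set (chart R Z))
    (f : homeo X Y) (g : homeo Y Z) :
  Cr_atlas r A -> Cr_atlas r B -> Cr_atlas r C ->
  Cr_diffeo r A B f -> Cr_diffeo r B C g -> Cr_diffeo r A C (homeo_comp g f).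
Proof.
move=> atA atB atC /(Cr_diffeoP _ atA atB) fi /(Cr_diffeoP _ atB atC) gi.
apply/Cr_diffeoP => // x; apply: Cr_iso_trans (fi x) _ => //.
by have := Cr_iso_pre (@hfun_cont _ _ f) (gi (f x)).
Qed.

End Structures.

(** * Homeomorphisms extending a homeomorphism of W *)

Section Extension.
Context {M : topologicalType} (W : set M).
Implicit Types X Y Z : set M.

(** Comparing points of M avoids the inclusion and invariance proofs that [restr] carries. *)
Definition extends {X Y} (f : X -> Y) (e : W -> W) : Prop :=
  forall (w : W) (x : X), set_val x = set_val w :> M ->
    set_val (f x) = set_val (e w) :> M.

Lemma extends_comp X Y Z (f : X -> Y) (g : Y -> Z) (d e : W -> W) :
  extends f d -> extends g e -> extends (g \o f) (e \o d).
Proof. by move=> fd ge w x xw; apply/ge/fd. Qed.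

Lemma extends_inv X Y (f : homeo X Y) (e : homeo W W) : W `<=` X ->
  extends f e -> extends (homeo_inv f) (homeo_inv e).
Proof.
move=> WX fe w y yw; have := fe (hinv e w) (set_incl WX (hinv e w)) erefl.
by rewrite hinvK -yw => /val_inj /= <-; rewrite hfunK.
Qed.

Lemma extends_restr X Y (WX : W `<=` X) (WY : W `<=` Y) (f : homeo X Y)
    (fW : maps_onto W f) : extends f (restr WX WY fW).
Proof.
move=> w x xw; rewrite /= (_ : x = set_incl WX w)//.
exact: val_inj.
Qed.

Lemma extends_maps_onto X Y (f : X -> Y) (e : homeo W W) :
  W `<=` X -> extends f e -> maps_onto W f.
Proof.
move=> WX fe; apply/seteqP; split=> [_ [x Wx <-]|y Wy].
  by rewrite /sub_in /= (fe (corestr Wx) x)//; exact: set_valP.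
pose w := hinv e (corestr Wy); exists (set_incl WX w).
  exact: (set_valP w).
by apply: val_inj; rewrite -[LHS]/(set_val _) (fe w)// hinvK.
Qed.

Lemma extends_restr_eq X Y (WX : W `<=` X) (WY : W `<=` Y) (f : homeo X Y)
    (fW : maps_onto W f) (e : homeo W W) :
  extends f e -> restr WX WY fW = e.
Proof. by move=> fe; apply: homeo_eq => w; apply: val_inj; exact: fe. Qed.

Lemma set_incl_continuous X (WX : W `<=` X) : continuous (set_incl WX).
Proof.
apply/continuousP => _ [S oS <-].
by have /continuousP/(_ _ oS) := @set_val_continuous M W.
Qed.

End Extension.

(** * Pasting homeomorphisms *)

Section Pasting.
Context {M : topologicalType}.
Implicit Types X Y W : set M.

Lemma continuous_at_set_val (N : topologicalType) X (f : M -> N) (x : X) :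
  open X -> {for x, continuous (f \o (set_val : X -> M))} ->
  {for (set_val x : M), continuous f}.
Proof.
move=> oX cf P /cf; rewrite /= nbhsE => -[S [oS Sx] SP].
apply: (@filterS _ _ _ (set_val @` S)).
  by move=> _ [y Sy <-]; exact: SP.
by apply: open_nbhs_nbhs; split; [exact: set_val_open | exists x].
Qed.

Lemma paste_fun X Y W (f : X -> M) (g : Y -> M) (e : W -> M) :
  X `|` Y = setT -> X `&` Y `<=` W ->
  (forall w x, set_val x = set_val w :> M -> f x = e w) ->
  (forall w y, set_val y = set_val w :> M -> g y = e w) ->
  exists h : M -> M, (forall x : X, h (set_val x) = f x) /\
                     (forall y : Y, h (set_val y) = g y).
Proof.
move=> XY XYW fe ge.
have fg x y : set_val x = set_val y :> M -> f x = g y.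
  move=> xy; have [|Wx] := pselect (W (set_val x)).
    move=> Wx; pose w : W := exist _ (set_val x) (mem_set Wx).
    by rewrite (fe w)// (ge w).
  by case: Wx; apply: XYW; split; [|rewrite xy]; exact: set_valP.
have /choice[h hP] (z : M) : exists w, (forall x, set_val x = z -> w = f x) /\
    (forall y, set_val y = z -> w = g y).
  have : setT z by []. rewrite -XY => -[Xz|Yz].
    exists (f (exist _ z (mem_set Xz))); split=> [x xz|y yz].
      by congr f; apply: val_inj; rewrite [RHS]xz.
    exact: fg.
  exists (g (exist _ z (mem_set Yz))); split=> [x xz|y yz].
    by apply/esym/fg.
  by congr g; apply: val_inj; rewrite [RHS]yz.
by exists h; split=> z; [exact: (hP _).1 | exact: (hP _).2].
Qed.

(** The target pair is kept separate from the source pair so that maps exchanging U and V are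
    covered. The inverse is pasted from the two inverses, which agree on W through the inverse of
    [e]. *)
Lemma paste_homeo X X' Y Y' W (f : homeo X X') (g : homeo Y Y')
    (e : homeo W W) :
  open X -> open X' -> open Y -> open Y' ->
  X `|` Y = setT -> X' `|` Y' = setT -> X `&` Y = W -> X' `&` Y' = W ->
  extends f e -> extends g e ->
  exists h : homeo M M, (forall x : X, h (set_val x) = set_val (f x)) /\
                        (forall y : Y, h (set_val y) = set_val (g y)).
Proof.
move=> oX oX' oY oY' XY XY' XYW XYW' fe ge.
have WX : W `<=` X by rewrite -XYW; exact: subIsetl.
have WY : W `<=` Y by rewrite -XYW; exact: subIsetr.
have [|h [hf hg]] := @paste_fun X Y W (set_val \o f) (set_val \o g)
  (set_val \o e) XY _ fe ge; first by rewrite XYW.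
have [|h' [hf' hg']] := @paste_fun X' Y' W (set_val \o hinv f)
  (set_val \o hinv g) (set_val \o hinv e) XY' _ (extends_inv WX fe)
  (extends_inv WY ge); first by rewrite XYW'.
have inXY (Z Z' : set M) z : Z `|` Z' = setT ->
    (exists x : Z, z = set_val x) \/ (exists y : Z', z = set_val y).
  move=> ZZ; have : setT z by []. rewrite -ZZ => -[Zz|Zz]; [left|right].
    by exists (exist _ z (mem_set Zz)).
  by exists (exist _ z (mem_set Zz)).
have hK : cancel h h'.
  move=> z; have [[x ->]|[y ->]] := inXY X Y z XY.
    by rewrite hf /= hf' /= hfunK.
  by rewrite hg /= hg' /= hfunK.
have h'K : cancel h' h.
  move=> z; have [[x ->]|[y ->]] := inXY X' Y' z XY'.
    by rewrite hf' /= hf /= hinvK.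
  by rewrite hg' /= hg /= hinvK.
have cvc (Z Z' : set M) (k : Z -> Z') : continuous k ->
    continuous (set_val \o k : Z -> M).
  move=> ck z; apply: continuous_comp; first exact: ck.
  exact: set_val_continuous.
have ch : continuous h.
  move=> z; have [[x ->]|[y ->]] := inXY X Y z XY.
    apply: continuous_at_set_val => //.
    rewrite (_ : h \o _ = set_val \o f); first exact/cvc/hfun_cont.
    exact/funext.
  apply: continuous_at_set_val => //.
  rewrite (_ : h \o _ = set_val \o g); first exact/cvc/hfun_cont.
  exact/funext.
have ch' : continuous h'.
  move=> z; have [[x ->]|[y ->]] := inXY X' Y' z XY'.
    apply: continuous_at_set_val => //.
    rewrite (_ : h' \o _ = set_val \o hinv f); first exact/cvc/hinv_cont.
    exact/funext.
  apply: continuous_at_set_val => //.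
  rewrite (_ : h' \o _ = set_val \o hinv g); first exact/cvc/hinv_cont.
  exact/funext.
by exists (Homeo hK h'K ch ch').
Qed.

Lemma homeo_img_inv (h : homeo M M) X Y : h @` X = Y -> hinv h @` Y = X.
Proof.
move=> <-; apply/seteqP; split=> [_ [_ [x Xx <-] <-]|x Xx].
  by rewrite hfunK.
by exists (h x); [exists x | rewrite hfunK].
Qed.

Lemma homeo_sub_fun (h : M -> M) X Y : continuous h -> h @` X `<=` Y ->
  exists2 f : X -> Y,
    continuous f & forall x, set_val (f x) = h (set_val x) :> M.
Proof.
move=> ch hXY; have hY (x : X) : Y (h (set_val x)).
  by apply: hXY; exists (set_val x) => //; exact: set_valP.
exists (fun x => exist _ (h (set_val x)) (mem_set (hY x))) => //.
apply/continuousP => _ [S oS <-].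
have /continuousP/(_ _ oS) : continuous (h \o (set_val : X -> M)).
  by move=> x; apply: continuous_comp; [exact: set_val_continuous | exact: ch].
by [].
Qed.

Lemma homeo_sub (h : homeo M M) X Y : h @` X = Y ->
  exists f : homeo X Y, forall x, set_val (f x) = h (set_val x) :> M.
Proof.
move=> hXY; have hYX := homeo_img_inv hXY.
have [|f cf fE] := @homeo_sub_fun h X Y (@hfun_cont _ _ h).
  by rewrite hXY.
have [|g cg gE] := @homeo_sub_fun (hinv h) Y X (@hinv_cont _ _ h).
  by rewrite hYX.
have fK : cancel f g.
  by move=> x; apply: val_inj; rewrite [LHS]gE fE hfunK.
have gK : cancel g f.
  by move=> x; apply: val_inj; rewrite [LHS]fE gE hinvK.
by exists (Homeo fK gK cf cg).
Qed.

End Pasting.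

(** * Charts pulled back along a self-homeomorphism of an open subset *)

Section Pull.
Context {R : realType} (r : smoothness) {M : topologicalType}.
Implicit Types (X : set M) (A S : set (chart R M)).

Lemma chart_pull_val X (f : X -> X) (c : chart R X) x :
  chart_map (chart_pull f c) (set_val x) = chart_map c (f x).
Proof. by rewrite /= valK. Qed.

Lemma chart_pull_dom X (f : X -> X) (c : chart R X) x :
  chart_dom (chart_pull f c) (set_val x) <-> chart_dom c (f x).
Proof.
split=> [[y cy /val_inj <-] //|cx]; by exists x.
Qed.

Lemma is_chart_pull X (f : homeo X X) (c : chart R X) : open X -> is_chart c ->
  is_chart (chart_pull f c).
Proof.
move=> oX [oc [k [l [l0 cl cinj cc cimg]]]]; split.
  apply: set_val_open => //; apply: open_comp => // x _; exact: hfun_cont.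
exists k, l; split.
- exact: l0.
- by move=> _ [x cx <-]; rewrite chart_pull_val; exact: cl.
- move=> _ _ /set_mem[x cx <-] /set_mem[y cy <-]; rewrite !chart_pull_val => xy.
  congr (set_val _); apply: (can_inj (@hfunK _ _ f)).
  by apply: cinj xy; exact/mem_set.
- move=> _ [x cx <-].
  apply: (@continuous_at_set_val M 'rV[R]_(chart_dim c) X _ x oX).
  rewrite (_ : _ \o _ = chart_map c \o f); last first.
    by apply/funext => y; exact: chart_pull_val.
  by apply: continuous_comp; [exact: hfun_cont | exact: cc].
move=> N oN Nc; have [||B oB BE] := cimg (hinv f @^-1` (set_val @^-1` N)).
- apply: open_comp => [x _|]; first exact: hinv_cont.
  by apply: open_comp => // x _; exact: set_val_continuous.
- by move=> x /Nc /chart_pull_dom; rewrite hinvK.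
exists B => //; rewrite -BE; apply/seteqP; split=> [_ [x Nx <-]|_ [x Nx <-]].
  have [y cy yx] := Nc x Nx; subst x.
  exists (f y); last by rewrite chart_pull_val.
  by rewrite /= hfunK.
by exists (set_val (hinv f x)) => //; rewrite chart_pull_val hinvK.
Qed.

(** Read in [chart_pull f c] and [c], the map [f] is the identity. Since [S] is any family
    containing the pulled-back chart, it may be a singleton. *)
Lemma chart_pull_iso_at X (f : homeo X X) (c : chart R X) A S x : open X ->
  Cr_atlas r A -> atlas_restr X A c -> S (chart_pull f c) ->
  chart_dom c (f x) -> Cr_iso r S A (set_val : X -> M) (set_val \o f) x.
Proof.
move=> oX atA Acc Sfc cfx.
suff : Cr_iso r S (atlas_restr X A) (set_val : X -> M) f x.
  by rewrite /Cr_iso Cr_at_restrl Cr_at_restrr.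
have [Ac _ _] := atlas_restr_atlas oX atA.
have E : chart_map (chart_pull f c) \o (set_val : X -> M) = chart_map c \o f.
  by apply/funext => y; exact: chart_pull_val.
have oN : open (f @^-1` chart_dom c).
  by apply: open_comp; [move=> y _; exact: hfun_cont | exact: (Ac c Acc).1].
split.
  exists (chart_pull f c); split=> //.
  exists c; split=> //; exists (f @^-1` chart_dom c); split=> //.
    by move=> y cy; split=> //; apply/chart_pull_dom.
  by rewrite E; exact: Cr_rep_id.
exists c; split=> //; exists (chart_pull f c); split=> //.
exists (f @^-1` chart_dom c); split=> //.
  by move=> y cy; split=> //; apply/chart_pull_dom.
by rewrite E; exact: Cr_rep_id.
Qed.

Lemma chart_pull_iso X (f : homeo X X) A S : open X -> Cr_atlas r A ->
  (forall c, atlas_restr X A c -> S (chart_pull f c)) ->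
  forall x, Cr_iso r S A (set_val : X -> M) (set_val \o f) x.
Proof.
move=> oX atA AS x.
have [_ Acov _] := atlas_restr_atlas oX atA; have : setT (f x) by [].
rewrite -Acov => -[c Acc cfx].
exact: chart_pull_iso_at oX atA Acc (AS _ Acc) cfx.
Qed.

End Pull.

(** * Extendable homeomorphisms of W and the double coset relation *)

Section Extensions.
Context {R : realType} (r : smoothness) {M : topologicalType}.
Variables (A : set (chart R M)) (U V : set M).
Hypotheses (atA : Cr_atlas r A) (oU : open U) (oV : open V).
Local Notation W := (Win U V).
Implicit Types (X Y Z : set M) (d e : homeo W W).
Local Open Scope group_scope.

(** The topological version decides which elements of D(W) are transition maps, since the members of
    a (U, V)-atlas are mere homeomorphisms. *)
Definition top_ext X Y e : Prop := exists f : homeo X Y, extends f e.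

(** These are the arrows of a groupoid on the open sets containing W: E_U(W) consists of the arrows
    from U to U, D(W) of those from W to W, and eta gives one from U to V. *)
Definition Cr_ext X Y e : Prop :=
  exists2 f : homeo X Y, extends f e &
    Cr_diffeo r (atlas_restr X A) (atlas_restr Y A) f.

Lemma Cr_ext_top X Y e : Cr_ext X Y e -> top_ext X Y e.
Proof. by move=> [f fe _]; exists f. Qed.

Lemma top_extM X Y Z d e :
  top_ext X Y d -> top_ext Y Z e -> top_ext X Z (e * d).
Proof.
by move=> [f fd] [g ge]; exists (homeo_comp g f); exact: extends_comp fd ge.
Qed.

Lemma top_extV X Y e : W `<=` X -> top_ext X Y e -> top_ext Y X e^-1.
Proof. by move=> WX [f fe]; exists (homeo_inv f); exact: extends_inv. Qed.

Lemma Cr_extM X Y Z d e : open X -> open Y -> open Z ->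
  Cr_ext X Y d -> Cr_ext Y Z e -> Cr_ext X Z (e * d).
Proof.
move=> oX oY oZ [f fd fC] [g ge gC]; exists (homeo_comp g f).
  exact: extends_comp fd ge.
by apply: Cr_diffeo_comp fC gC; exact: atlas_restr_atlas.
Qed.

Lemma Cr_extV X Y e : W `<=` X -> Cr_ext X Y e -> Cr_ext Y X e^-1.
Proof.
move=> WX [f fe fC]; exists (homeo_inv f); first exact: extends_inv.
exact: Cr_diffeo_inv.
Qed.

Lemma Cr_ext1 X : open X -> Cr_ext X X 1.
Proof.
move=> oX; exists (homeo_id X) => //.
by apply: Cr_diffeo_id; exact: atlas_restr_atlas.
Qed.

Let oW : open W. Proof. exact: openI. Qed.

Lemma diffeoWP e : diffeoW r A U V e <-> Cr_ext W W e.
Proof.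
split=> [eC|[f fe]]; first by exists e => // w x /val_inj ->.
suff -> : e = f by [].
by apply: homeo_eq => w; apply: val_inj; exact/esym/(fe w w).
Qed.

Lemma diffeoWM d e :
  diffeoW r A U V d -> diffeoW r A U V e -> diffeoW r A U V (d * e).
Proof.
by move=> /diffeoWP dC /diffeoWP eC; apply/diffeoWP/(Cr_extM _ _ _ eC dC).
Qed.

Lemma diffeoWV e : diffeoW r A U V e -> diffeoW r A U V e^-1.
Proof. by move=> /diffeoWP eC; apply/diffeoWP/(Cr_extV _ eC). Qed.

Lemma Cr_ext_diffeoW X Y e : W `<=` X -> open X -> open Y ->
  Cr_ext X Y e -> diffeoW r A U V e.
Proof.
move=> WX oX oY [f fe /(Cr_diffeo_restrP _ atA oX oY) fC].
apply/(Cr_diffeo_restrP _ atA oW oW) => w.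
have := Cr_iso_pre (set_incl_continuous (WX := WX)) (fC (set_incl WX w)).
rewrite (_ : (set_val \o f) \o _ = set_val \o e)//.
by apply/funext => x /=; exact: fe.
Qed.

Lemma extUP e : extU r A U V e <-> Cr_ext U U e.
Proof.
split=> [[f [fW [fC ->]]]|[f fe fC]].
  by exists f => //; exact: extends_restr.
exists f, (extends_maps_onto (@Win_l _ U V) fe); split=> //.
by rewrite /restrUU (extends_restr_eq _ _ _ fe).
Qed.

Lemma restrUV_ext (eta : homeo U V) (eta_in : diffeoUV r A U V eta) :
  Cr_ext U V (restrUV eta_in.2).
Proof. by exists eta; [exact: extends_restr | exact: eta_in.1]. Qed.

(** The coset relation without eta. Its two cases mirror the homeomorphisms of M that preserve U and
    V and those that exchange them. *)
Definition related (g g' : homeo W W) : Prop :=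
  (exists a b, [/\ Cr_ext U U a, Cr_ext V V b & g' = b * g * a^-1]) \/
  (exists a b, [/\ Cr_ext U V a, Cr_ext V U b & g' = a * g^-1 * b^-1]).

Let WU : W `<=` U := @Win_l _ U V.
Let WV : W `<=` V := @Win_r _ U V.

Definition homeo_word := (@invgM, @invgK, @mulgA, @mulgK, @mulgVK, @mulgV,
  @mulVg, @mulg1, @mul1g, @invg1).

(** A wreath element (a, b, +1) corresponds to the pair a, e b e^-1, and (a, b, -1) to the crossing
    pair e a, b e^-1. *)
Lemma double_cosetP e g g' : Cr_ext U V e ->
  double_coset r A U V e g g' <-> related g g'.
Proof.
move=> eE; have eV := Cr_extV WU eE; split.
  move=> [[a b s] [/= /extUP aE /extUP bE] <-]; case: s; [right|left].
    exists (e * a), (b * e^-1); split.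
    - exact: Cr_extM aE eE.
    - exact: Cr_extM eV bE.
    - by rewrite !homeo_word.
  exists a, (e * b * e^-1); split=> //; last by rewrite !homeo_word.
  exact: Cr_extM eV (Cr_extM _ _ _ bE eE).
move=> [[a [b [aE bE ->]]]|[a [b [aE bE ->]]]].
  exists (Wreath a (e^-1 * b * e) false); last by rewrite /= !homeo_word.
  split; apply/extUP => //=; exact: Cr_extM eE (Cr_extM _ _ _ bE eV).
exists (Wreath (e^-1 * a) (b * e) true); last by rewrite /= !homeo_word.
split; apply/extUP => /=; first exact: Cr_extM aE eV.
exact: Cr_extM eE bE.
Qed.

Lemma related_refl g : related g g.
Proof.
left; exists 1, 1; split; [exact: Cr_ext1|exact: Cr_ext1|].
by rewrite !homeo_word.
Qed.

Lemma related_sym g g' : related g g' -> related g' g.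
Proof.
move=> [[a [b [aE bE ->]]]|[a [b [aE bE ->]]]].
  left; exists a^-1, b^-1; split; [exact: Cr_extV aE|exact: Cr_extV bE|].
  by rewrite !homeo_word.
right; exists b^-1, a^-1; split; [exact: Cr_extV bE|exact: Cr_extV aE|].
by rewrite !homeo_word.
Qed.

Lemma related_trans g1 g2 g3 : related g1 g2 -> related g2 g3 -> related g1 g3.
Proof.
move=> [[a [b [aE bE ->]]]|[a [b [aE bE ->]]]];
  move=> [[c [d [cE dE ->]]]|[c [d [cE dE ->]]]].
- left; exists (c * a), (d * b); split; last by rewrite !homeo_word.
    exact: Cr_extM aE cE.
  exact: Cr_extM bE dE.
- right; exists (c * a), (d * b); split; last by rewrite !homeo_word.
    exact: Cr_extM aE cE.
  exact: Cr_extM bE dE.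
- right; exists (d * a), (c * b); split; last by rewrite !homeo_word.
    exact: Cr_extM aE dE.
  exact: Cr_extM bE cE.
- left; exists (d * a), (c * b); split; last by rewrite !homeo_word.
    exact: Cr_extM aE dE.
  exact: Cr_extM bE cE.
Qed.

Lemma related_set_eq g g' :
  [set x | related g x] = [set x | related g' x] <-> related g g'.
Proof.
split=> [E|gg'].
  have := related_refl g'.
  by rewrite -[related g' g']/([set x | related g' x] g') -E.
apply/seteqP; split=> x; apply: related_trans => //.
exact: related_sym.
Qed.

Lemma wreath_act_is_action e : Cr_ext U V e ->
  is_action (wreath_set (extU r A U V)) (diffeoW r A U V) (wreath_act e).
Proof.
move=> eE; have eD := Cr_ext_diffeoW WU oU oV eE.
have UD a : extU r A U V a -> diffeoW r A U V a.
  by move=> /extUP; exact: Cr_ext_diffeoW.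
have UM a b : extU r A U V a -> extU r A U V b -> extU r A U V (a * b).
  by move=> /extUP aE /extUP bE; apply/extUP/(Cr_extM _ _ _ bE aE).
have UV a : extU r A U V a -> extU r A U V a^-1.
  by move=> /extUP aE; apply/extUP/(Cr_extV _ aE).
split.
- split.
  + by split; apply/extUP/Cr_ext1.
  + by move=> [a b s] [c d []] [/= aE bE] [/= cE dE]; split=> /=; exact: UM.
  + by move=> [a b []] [/= aE bE]; split=> /=; exact: UV.
- move=> [a b []] g [/= /UD aD /UD bD] gD;
    do ![apply: diffeoWM|apply: diffeoWV] => //.
- by move=> g _; rewrite /= !homeo_word.
- by move=> [a b []] [c d []] g _ _ _; rewrite /= !homeo_word.
Qed.

End Extensions.

(** * Diffeomorphisms of induced structures *)

Section Transport.
Context {R : realType} (r : smoothness) {M : topologicalType}.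
Variables (A : set (chart R M)) (U V : set M).
Hypotheses (atA : Cr_atlas r A) (oU : open U) (oV : open V).
Local Notation W := (Win U V).
Implicit Types (S T : set (chart R M)).
Local Open Scope group_scope.

Lemma Cr_iso_set_val (Y Z : topologicalType) (S : set (chart R Y))
    (S' : set (chart R Z)) (X : set M) (u : M -> Y) (v : M -> Z) (x : X) :
  open X -> Cr_iso r S S' (u \o (set_val : X -> M)) (v \o set_val) x ->
  Cr_iso r S S' u v (set_val x).
Proof.
by move=> oX; apply: Cr_iso_img => N; exact: set_val_open.
Qed.

Lemma homeo_imgI (h : homeo M M) (X Y : set M) :
  h @` (X `&` Y) = (h @` X) `&` (h @` Y).
Proof.
apply/seteqP; split=> [_ [x [Xx Yx] <-]|_ [[x Xx <-] [y Yy yx]]].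
  by split; exists x.
move/(can_inj (@hfunK _ _ h)): yx => yx.
by exists x => //; split=> //; rewrite -yx.
Qed.

(** [f] and [f'] identify S on X and T on X' with the given atlas, so f' h f^-1 is a diffeomorphism
    for that atlas. Taking X = U and X' = V handles exchanges. *)
Lemma transport_ext S T (X X' : set M) (f : homeo X X) (f' : homeo X' X')
    (p p' k : homeo W W) (h : homeo M M) :
  Cr_atlas r S -> Cr_atlas r T -> open X -> open X' -> W `<=` X ->
  extends f p -> extends f' p' ->
  (forall x, Cr_iso r S A (set_val : X -> M) (set_val \o f) x) ->
  (forall x, Cr_iso r T A (set_val : X' -> M) (set_val \o f') x) ->
  Cr_diffeo r S T h -> h @` X = X' ->
  (forall w, set_val (k w) = h (set_val w)) ->
  Cr_ext r A X X' (p' * k * p^-1).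
Proof.
move=> atS atT oX oX' WX fp fp' Sf Tf' /(Cr_diffeoP _ atS atT) hST hX kh.
have [hs hsE] := homeo_sub hX.
have hsk : extends hs k by move=> w x xw; rewrite hsE xw kh.
exists (homeo_comp (homeo_comp f' hs) (homeo_inv f)).
  exact: extends_comp (extends_inv WX fp) (extends_comp hsk fp').
apply/Cr_diffeo_restrP => // x; set y := hinv f x.
have := @Cr_iso_pre _ r _ _ _ _ A A (set_val \o f) (set_val \o f' \o hs)
  (hinv f) x (@hinv_cont _ _ f).
rewrite (_ : (set_val \o f) \o hinv f = set_val); last first.
  by apply/funext => z /=; rewrite hinvK.
apply; apply: Cr_iso_trans atS (Cr_iso_sym (Sf y)) _.
apply: Cr_iso_trans atT (Cr_iso_pre (@set_val_continuous _ _) (hST _)) _.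
have := Cr_iso_pre (@hfun_cont _ _ hs) (Tf' (hs y)).
rewrite (_ : set_val \o hs = h \o set_val)//.
by apply/funext => z /=; exact: hsE.
Qed.

(** The reverse passage, by f'^-1 g f. *)
Lemma transport_iso S T (X X' : set M) (f : homeo X X) (f' : homeo X' X')
    (p p' e : homeo W W) :
  Cr_atlas r S -> Cr_atlas r T -> open X -> open X' -> W `<=` X' ->
  extends f p -> extends f' p' ->
  (forall x, Cr_iso r S A (set_val : X -> M) (set_val \o f) x) ->
  (forall x, Cr_iso r T A (set_val : X' -> M) (set_val \o f') x) ->
  Cr_ext r A X X' e ->
  exists2 k : homeo X X', extends k (p'^-1 * e * p) &
    forall x, Cr_iso r S T (set_val : X -> M) (set_val \o k) x.
Proof.
move=> atS atT oX oX' WX' fp fp' Sf Tf' [g ge].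
move=> /(Cr_diffeo_restrP _ atA oX oX') gA.
exists (homeo_comp (homeo_comp (homeo_inv f') g) f).
  exact: extends_comp fp (extends_comp ge (extends_inv WX' fp')).
move=> x; apply: Cr_iso_trans atA (Sf x) _.
apply: Cr_iso_trans atA (Cr_iso_pre (@hfun_cont _ _ f) (gA (f x))) _.
set k := homeo_comp _ f; apply: Cr_iso_sym.
have := Cr_iso_pre (@hfun_cont _ _ k) (Tf' (k x)).
rewrite (_ : (set_val \o f') \o k = (set_val \o g) \o f)//.
by apply/funext => z /=; rewrite hinvK.
Qed.

Lemma paste_diffeo S T (X X' Y Y' : set M) (f : homeo X X') (g : homeo Y Y')
    (e : homeo W W) :
  Cr_atlas r S -> Cr_atlas r T ->
  open X -> open X' -> open Y -> open Y' ->
  X `|` Y = setT -> X' `|` Y' = setT -> X `&` Y = W -> X' `&` Y' = W ->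
  extends f e -> extends g e ->
  (forall x, Cr_iso r S T (set_val : X -> M) (set_val \o f) x) ->
  (forall y, Cr_iso r S T (set_val : Y -> M) (set_val \o g) y) ->
  exists h : homeo M M, [/\ h @` X = X', h @` Y = Y' & Cr_diffeo r S T h].
Proof.
move=> atS atT oX oX' oY oY' XY XY' XYW XYW' fe ge fi gi.
have [h [hf hg]] := paste_homeo oX oX' oY oY' XY XY' XYW XYW' fe ge.
have img (Z Z' : set M) (l : homeo Z Z') :
    (forall z, h (set_val z) = set_val (l z)) -> h @` Z = Z'.
  move=> hl; apply/seteqP; split=> [_ [z Zz <-]|z Zz].
    rewrite -[z]/(set_val (exist _ z (mem_set Zz) : Z)) hl; exact: set_valP.
  pose z' : Z' := exist _ z (mem_set Zz).
  by exists (set_val (hinv l z')); [exact: set_valP | rewrite hl hinvK].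
exists h; split; [exact: img hf | exact: img hg |].
apply/Cr_diffeoP => // z.
have : setT z by []. rewrite -XY => -[Zz|Zz].
  rewrite -[z]/(set_val (exist _ z (mem_set Zz) : X)).
  apply: Cr_iso_set_val => //.
  by rewrite (_ : h \o _ = set_val \o f)//; exact/funext.
rewrite -[z]/(set_val (exist _ z (mem_set Zz) : Y)).
apply: Cr_iso_set_val => //.
by rewrite (_ : h \o _ = set_val \o g)//; exact/funext.
Qed.

Hypothesis UV : U `|` V = setT.

Let WU : W `<=` U := @Win_l _ U V.
Let WV : W `<=` V := @Win_r _ U V.
Let VU : V `|` U = setT. Proof. by rewrite setUC. Qed.
Let VUW : V `&` U = W. Proof. by rewrite setIC. Qed.

(** * The atlas induced by a (U, V)-atlas *)

Section UVAtlas.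
Variable a : uv_atlas r A U V.
Local Notation phi := (uv_phi a).
Local Notation psi := (uv_psi a).
Local Notation p := (restrUU (uv_phiW a)).
Local Notation q := (restrVV (uv_psiW a)).

Lemma uv_phi_extends : extends phi p. Proof. exact: extends_restr. Qed.
Lemma uv_psi_extends : extends psi q. Proof. exact: extends_restr. Qed.

Lemma uv_phi_iso S : induced_atlas a `<=` S ->
  forall x, Cr_iso r S A (set_val : U -> M) (set_val \o phi) x.
Proof.
by move=> aS; apply: chart_pull_iso => // c Ac; apply: aS; left; exists c.
Qed.

Lemma uv_psi_iso S : induced_atlas a `<=` S ->
  forall x, Cr_iso r S A (set_val : V -> M) (set_val \o psi) x.
Proof.
by move=> aS; apply: chart_pull_iso => // c Ac; apply: aS; right; exists c.
Qed.

Let oW : open W. Proof. exact: openI. Qed.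

Lemma transition_iso w :
  Cr_iso r A A ((set_val : W -> M) \o p) ((set_val : W -> M) \o q) w.
Proof.
have /(Cr_diffeo_restrP _ atA oW oW) := uv_diffeo a.
move=> /(_ (p w)) /(Cr_iso_pre (@hfun_cont _ _ p)).
rewrite (_ : (set_val \o _) \o p = set_val \o q)//.
by apply/funext => x; rewrite /= -[in RHS](hfunK p x).
Qed.

Lemma induced_atlas_atlas : Cr_atlas r (induced_atlas a).
Proof.
have [AU AUcov _] := atlas_restr_atlas oU atA.
have [AV AVcov _] := atlas_restr_atlas oV atA.
have Qc c : induced_atlas a c -> is_chart c.
  move=> [[d Ad <-]|[d Ad <-]]; apply: is_chart_pull => //.
    exact: AU.
  exact: AV.
have same (X : set M) (f : homeo X X) c d x : open X ->
    atlas_restr X A c -> atlas_restr X A d ->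
    chart_dom (chart_pull f c) x -> chart_dom (chart_pull f d) x ->
    Cr_iso r [set chart_pull f c] [set chart_pull f d] id id x.
  move=> oX Ac Ad [t ct <-] /chart_pull_dom dt.
  apply: Cr_iso_set_val => //.
  apply: Cr_iso_trans atA (chart_pull_iso_at oX atA Ac _ ct) _ => //.
  exact/Cr_iso_sym/(chart_pull_iso_at oX atA Ad).
(* A U-chart and a V-chart meet inside W, where the chain goes from the first to the given atlas by
   [phi], across by the transition map, and back by [psi]. *)
have mixed c d x : atlas_restr U A c -> atlas_restr V A d ->
    chart_dom (chart_pull phi c) x -> chart_dom (chart_pull psi d) x ->
    Cr_iso r [set chart_pull phi c] [set chart_pull psi d] id id x.
  move=> Ac Ad cx dx; have Wx : W x.
    by split; [case: cx | case: dx] => t _ <-; exact: set_valP.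
  pose w : W := exist _ x (mem_set Wx).
  have cw : chart_dom c (phi (set_incl WU w)) by apply/chart_pull_dom.
  have dw : chart_dom d (psi (set_incl WV w)) by apply/chart_pull_dom.
  rewrite -[x]/(set_val w).
  apply: Cr_iso_set_val => //.
  have /(Cr_iso_pre (set_incl_continuous (WX := WU))) ci :=
    chart_pull_iso_at (S := [set chart_pull phi c]) oU atA Ac erefl cw.
  have /(Cr_iso_pre (set_incl_continuous (WX := WV))) di :=
    chart_pull_iso_at (S := [set chart_pull psi d]) oV atA Ad erefl dw.
  apply: Cr_iso_trans atA ci _.
  exact: Cr_iso_trans atA (transition_iso w) (Cr_iso_sym di).
(* The singletons force the witnesses of [Cr_iso] to be [c] and [d] themselves, so that it yields
   their compatibility near [x]. *)
have iso c d x : induced_atlas a c -> induced_atlas a d ->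
    chart_dom c x -> chart_dom d x -> Cr_iso r [set c] [set d] id id x.
  move=> [[c' Ac' <-]|[c' Ac' <-]] [[d' Ad' <-]|[d' Ad' <-]] cx dx.
  - exact: same.
  - exact: mixed.
  - exact/Cr_iso_sym/mixed.
  - exact: same.
have rep c d : induced_atlas a c -> induced_atlas a d ->
    Cr_rep r (chart_dom c `&` chart_dom d) (chart_map c) (chart_map d).
  move=> ac ad; apply: Cr_rep_local; [exact: Qc|by move=> ? []|].
  move=> x [cx dx].
  have [[_ [-> [_ [-> [N [oN Nx _ rN]]]]]] _] := iso c d x ac ad cx dx.
  by exists N; split=> //; apply: Cr_rep_sub rN => ? [].
split=> //.
  apply/seteqP; split=> // x _; have : setT x by [].
  rewrite -UV => -[Xx|Xx].
    have : setT (phi (exist _ x (mem_set Xx))) by [].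
    rewrite -AUcov => -[c Ac cx]; exists (chart_pull phi c).
      by left; exists c.
    by exists (exist _ x (mem_set Xx)).
  have : setT (psi (exist _ x (mem_set Xx))) by [].
  rewrite -AVcov => -[c Ac cx]; exists (chart_pull psi c).
    by right; exists c.
  by exists (exist _ x (mem_set Xx)).
by move=> c d ac ad; split; [exact: rep | rewrite setIC; exact: rep].
Qed.

End UVAtlas.

(** If [h] restricts to k on W, then q' p'^-1 = (q' k q^-1) (q p^-1) (p' k p^-1)^-1, and the outer
    factors extend over V and U; in the exchanging case the middle factor is inverted. *)
Lemma uv_equiv_related (a a' : uv_atlas r A U V) S T :
  Cr_atlas r S -> Cr_atlas r T ->
  induced_atlas a `<=` S -> induced_atlas a' `<=` T ->
  uv_equiv r U V S T <-> related r A (transition a) (transition a').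
Proof.
move=> atS atT aS aT.
have fp := uv_phi_extends a; have gq := uv_psi_extends a.
have fp' := uv_phi_extends a'; have gq' := uv_psi_extends a'.
have Sf := uv_phi_iso aS; have Sg := uv_psi_iso aS.
have Tf := uv_phi_iso aT; have Tg := uv_psi_iso aT.
rewrite /transition; move: (restrUU (uv_phiW a)) (restrVV (uv_psiW a)) fp gq.
move: (restrUU (uv_phiW a')) (restrVV (uv_psiW a')) fp' gq'.
move=> p' q' fp' gq' p q fp gq; split.
  move=> [h hUV hC]; have hW : h @` W = W.
    by rewrite /Win homeo_imgI; case: hUV => -[-> ->] //; rewrite setIC.
  have [k kE] := homeo_sub hW.
  case: hUV => -[hU hV]; [left | right].
    exists (p' * k * p^-1), (q' * k * q^-1); split; last by rewrite !homeo_word.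
      exact: transport_ext atS atT oU oU WU fp fp' Sf Tf hC hU kE.
    exact: transport_ext atS atT oV oV WV gq gq' Sg Tg hC hV kE.
  exists (q' * k * p^-1), (p' * k * q^-1); split; last by rewrite !homeo_word.
    exact: transport_ext atS atT oU oV WU fp gq' Sf Tg hC hU kE.
  exact: transport_ext atS atT oV oU WV gq fp' Sg Tf hC hV kE.
move=> [[b [c [bE cE E]]]|[b [c [bE cE E]]]].
  have [f fk fi] := transport_iso atS atT oU oU WU fp fp' Sf Tf bE.
  have [g gk gi] := transport_iso atS atT oV oV WV gq gq' Sg Tg cE.
  (* The coset equation [E] says exactly that the two lifts agree on W, which is what pasting
     requires. *)
  have kE : q'^-1 * c * q = p'^-1 * b * p.
    by rewrite -[q'](mulgVK p') E !homeo_word.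
  rewrite kE in gk.
  have [h [hU hV hC]] :=
    paste_diffeo atS atT oU oU oV oV UV UV erefl erefl fk gk fi gi.
  by exists h => //; left.
have [f fk fi] := transport_iso atS atT oU oV WV fp gq' Sf Tg bE.
have [g gk gi] := transport_iso atS atT oV oU WU gq fp' Sg Tf cE.
have kE : p'^-1 * c * q = q'^-1 * b * p.
  by rewrite -[q'](mulgVK p') E !homeo_word.
rewrite kE in gk.
have [h [hU hV hC]] :=
  paste_diffeo atS atT oU oV oV oU UV VU erefl VUW fk gk fi gi.
by exists h => //; right.
Qed.

(** With [transition_top_ext] this characterises transition maps inside D(W) by a topological
    factorisation. *)
Lemma transition_ext g (p q : homeo W W) : diffeoW r A U V g ->
  top_ext U U p -> top_ext V V q -> g = q * p^-1 ->
  exists a : uv_atlas r A U V, transition a = g.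
Proof.
move=> gD [f fp] [f' fq] gE.
have fW := extends_maps_onto WU fp; have f'W := extends_maps_onto WV fq.
have E : restrVV f'W * (restrUU fW)^-1 = g.
  rewrite gE /restrVV (extends_restr_eq _ _ _ fq).
  by rewrite /restrUU (extends_restr_eq _ _ _ fp).
have D : diffeoW r A U V (restrVV f'W * (restrUU fW)^-1) by rewrite E.
by exists (UVAtlas D).
Qed.

Lemma transition_top_ext (a : uv_atlas r A U V) : exists p q,
  [/\ top_ext U U p, top_ext V V q & transition a = q * p^-1].
Proof.
exists (restrUU (uv_phiW a)), (restrVV (uv_psiW a)); split=> //.
  by exists (uv_phi a); exact: uv_phi_extends.
by exists (uv_psi a); exact: uv_psi_extends.
Qed.

(* If the class of some [e] extending to [U -> V] contains a transition map,
   then the identity of [W] extends to a homeomorphism [U -> V]: compare the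
   two factorisations of [e]. Such a homeomorphism exchanges the roles of [U]
   and [V], which turns the classes under [g |-> g^-1] into transition maps. *)
Lemma transition_related e (a0 a : uv_atlas r A U V) g :
  Cr_ext r A U V e -> related r A (transition a0) e ->
  related r A (transition a) g -> diffeoW r A U V g ->
  exists a' : uv_atlas r A U V, transition a' = g.
Proof.
move=> /Cr_ext_top eE ae ag gD.
have [p0 [q0 [p0E q0E t0]]] := transition_top_ext a0; rewrite t0 in ae.
have [p [q [pE qE aE]]] := transition_top_ext a; rewrite aE in ag.
have id1 : top_ext (U := U) (V := V) U V 1.
  (* [x] is a right factor of [e]: as a product of known arrows it leads from U to one of U and V,
     and cancelling the rest of [e] on the left leads to the other. *)
  suff [x xU xV] : exists2 x : homeo W W, top_ext U U x & top_ext U V x.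
    by rewrite -(mulgV x); exact: top_extM (top_extV WU xU) xV.
  case: ae => -[b [c [/Cr_ext_top bE /Cr_ext_top cE E]]].
    exists (p0^-1 * b^-1).
      exact: top_extM (top_extV WU bE) (top_extV WU p0E).
    have -> : p0^-1 * b^-1 = (c * q0)^-1 * e by rewrite E !homeo_word.
    exact: top_extM eE (top_extV WV (top_extM q0E cE)).
  exists (q0^-1 * c^-1); last first.
    exact: top_extM (top_extV WV cE) (top_extV WV q0E).
  have -> : q0^-1 * c^-1 = (b * p0)^-1 * e by rewrite E !homeo_word.
  exact: top_extM eE (top_extV WU (top_extM p0E bE)).
case: ag => -[b [c [/Cr_ext_top bE /Cr_ext_top cE E]]].
  apply: (transition_ext gD (p := b * p) (q := c * q)).
  - exact: top_extM pE bE.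
  - exact: top_extM qE cE.
  - by rewrite E !homeo_word.
have id1' : top_ext (U := U) (V := V) V U 1 by rewrite -invg1; exact: top_extV.
(* [c * q] runs from V to U and [b * p] from U to V; the extended identity turns them into self-maps
   of U and V with the same restriction to W. *)
apply: (transition_ext gD (p := c * q) (q := b * p)).
- by rewrite -(mulg1 (c * q)); exact: top_extM id1 (top_extM qE cE).
- by rewrite -(mulg1 (b * p)); exact: top_extM id1' (top_extM pE bE).
- by rewrite E !homeo_word.
Qed.

End Transport.

Theorem theorem4p3p3 (R : realType) (r : smoothness) (r_ge1 : r <> Some 0%N)
    (M : topologicalType) (A : set (chart R M)) (atlasA : Cr_atlas r A)
    (U V : set M) (openU : open U) (openV : open V)
    (UV_cover : U `|` V = [set: M])
    (UV_diffeo : diffeoUV r A U V !=set0) :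
  (forall (eta : homeo U V) (eta_in : diffeoUV r A U V eta),
     let e := restrUV eta_in.2 in
     [/\ is_action (wreath_set (extU r A U V)) (diffeoW r A U V) (wreath_act e),
         forall a b g, extU r A U V a -> extU r A U V b -> diffeoW r A U V g ->
           wreath_act e (Wreath a b false) g = ((e * b * e^-1) * g * a^-1)%g
       & forall a b g, extU r A U V a -> extU r A U V b -> diffeoW r A U V g ->
           wreath_act e (Wreath a b true) g = ((e * a) * g^-1 * (e * b^-1))%g])
  /\
  (forall (eta eta' : homeo U V) (eta_in : diffeoUV r A U V eta)
      (eta'_in : diffeoUV r A U V eta'),
     double_cosets r A U V (restrUV eta_in.2) =
     double_cosets r A U V (restrUV eta'_in.2))
  /\
  (exists mu : set (set (chart R M)) -> set (homeo (Win U V) (Win U V)),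
     forall (eta : homeo U V) (eta_in : diffeoUV r A U V eta),
     let e := restrUV eta_in.2 in
     let Q := uv_quotient r A U V in
     let D := double_cosets r A U V e in
     [/\ forall (a : uv_atlas r A U V) (S : set (chart R M)),
           Cr_structure r S -> induced_atlas a `<=` S ->
           mu (uv_class r A U V S) = double_coset r A U V e (transition a),
         set_fun Q D mu,
         set_inj Q mu
       & set_bij Q D mu <->
         forall g, diffeoW r A U V g ->
           exists a : uv_atlas r A U V, transition a = g]).
Proof.
have ext (eta : homeo U V) (eta_in : diffeoUV r A U V eta) :
  Cr_ext r A U V (restrUV eta_in.2) by exact: restrUV_ext.
have dcE e g : Cr_ext r A U V e ->
    double_coset r A U V e g = [set g' | related r A g g'].
  move=> eE; apply/seteqP.
  by split=> g' /(double_cosetP atlasA openU openV _ _ eE).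
have dcosE e : Cr_ext r A U V e -> double_cosets r A U V e =
    [set [set g' | related r A g g'] | g in diffeoW r A U V].
  move=> eE; rewrite /double_cosets /orbits; apply: eq_imagel => g _.
  exact: dcE.
split=> [eta eta_in e|].
  split; first exact: (wreath_act_is_action atlasA openU openV (ext _ eta_in)).
    by move=> a b g _ _ _; rewrite /= !homeo_word.
  by move=> a b g _ _ _; rewrite /= !homeo_word.
split=> [eta eta' eta_in eta'_in|]; first by rewrite !dcosE.
pose equiv_related S S' (a a' : uv_atlas r A U V) (SS : Cr_structure r S)
  (SS' : Cr_structure r S') (aS : induced_atlas a `<=` S)
  (aS' : induced_atlas a' `<=` S') :=
  uv_equiv_related atlasA openU openV UV_cover SS.1 SS'.1 aS aS'.
have rtrans := related_trans atlasA openU openV.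
pose coset (a : uv_atlas r A U V) := [set g | related r A (transition a) g].
have classE S S' (a a' : uv_atlas r A U V) (SS : Cr_structure r S)
    (SS' : Cr_structure r S') (aS : induced_atlas a `<=` S)
    (aS' : induced_atlas a' `<=` S') :
    uv_class r A U V S = uv_class r A U V S' <-> coset a = coset a'.
  rewrite /coset (related_set_eq atlasA openU openV); split=> [E|aa'].
    apply/(equiv_related _ _ _ _ SS SS' aS aS').
    suff : uv_class r A U V S S' by case.
    rewrite E; split; first by split=> //; exists a'.
    apply/(equiv_related _ _ _ _ SS' SS' aS' aS').
    exact: related_refl.
  apply/seteqP; split=> T [[ST [c cT]] /(equiv_related _ _ _ _ _ ST _ cT)].
    move=> /(_ a SS aS) ac; split; first by split=> //; exists c.
    apply/(equiv_related _ _ _ _ SS' ST aS' cT).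
    exact: rtrans (related_sym aa') ac.
  move=> /(_ a' SS' aS') ac; split; first by split=> //; exists c.
  apply/(equiv_related _ _ _ _ SS ST aS cT).
  exact: rtrans aa' ac.
(* Collecting over all representatives avoids choosing one, and [classE] shows that a single coset
   results. As eta does not occur, one map serves every eta. *)
pose mu (C : set (set (chart R M))) := [set g | exists S (a : uv_atlas r A U V),
  [/\ Cr_structure r S, induced_atlas a `<=` S, C = uv_class r A U V S
    & coset a g]].
have muE S a : Cr_structure r S -> induced_atlas a `<=` S ->
    mu (uv_class r A U V S) = coset a.
  move=> SS aS; apply/seteqP; split=> [g [S' [a' [SS' aS' E ag]]]|g ag].
    by rewrite ((classE _ _ _ _ SS SS' aS aS').1 E).
  by exists S, a.
exists mu => eta eta_in e Q D.
have eE : Cr_ext r A U V e by exact: ext.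
have DE : D = [set [set g' | related r A g g'] | g in diffeoW r A U V].
  exact: dcosE.
have muD : set_fun Q D mu.
  move=> _ [S [SS [a aS]] <-]; rewrite DE (muE S a)//.
  by exists (transition a) => //; exact: uv_diffeo.
have muI : set_inj Q mu.
  move=> _ _ /set_mem[S [SS [a aS]] <-] /set_mem[S' [SS' [a' aS']] <-].
  by rewrite (muE S a)// (muE S' a')// => /(classE _ _ _ _ SS SS' aS aS').
split=> //.
  by move=> a S SS aS; rewrite (muE S a)// dcE.
split=> [[_ _ surj]|trans].
  have tr g : diffeoW r A U V g -> exists a : uv_atlas r A U V,
      related r A (transition a) g.
    move=> gD; have [|C [S [SS [a aS]] <-]] := surj [set g' | related r A g g'].
      by rewrite DE; exists g.
    rewrite (muE S a)// => E; exists a.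
    exact/(related_set_eq atlasA openU openV).
  (* Surjectivity gives only a transition map related to [g]. Applying it also to [e], an element of
     D(W), supplies what is needed to reach [g] itself. *)
  move=> g gD; have [a ag] := tr g gD.
  have eD := Cr_ext_diffeoW atlasA openU openV (@Win_l _ U V) openU openV eE.
  have [a0 a0e] := tr e eD.
  exact: transition_related eE a0e ag gD.
split=> //; rewrite DE => _ [g /trans[a <-] <-].
have [S SS aS] :=
  structure_of_atlas (induced_atlas_atlas atlasA openU openV UV_cover a).
exists (uv_class r A U V S); last exact: muE.
by exists S => //; split=> //; exists a.
Qed.
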